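(* Let $A$ be a real operator space which is also an approximately unital Banach algebra. Then the following are equivalent: (i) The multiplication map $m:A\otimes_h A\to A$ is completely contractive. (ii) For any $n$, $M_n(A)$ is a Banach algebra; that is, $$\Big\|\Big[\sum_{k=1}^n a_{ik}b_{kj}\Big]\Big\|_{M_n(A)}\le \|[a_{ij}]\|_{M_n(A)}\,\|[b_{ij}]\|_{M_n(A)}$$ for all $[a_{ij}],[b_{ij}]\in M_n(A)$. (iii) $A$ is a real operator algebra; that is, there exist a real Hilbert space $H$ and a completely isometric homomorphism $\pi:A\to B(H)$.
   Context: A real operator space is a real vector space with matrix norms that is completely isometric to a norm-closed subspace of $B(H)$ for some real Hilbert space $H$ (with $M_n(B(H))=B(H^n)$). ''Approximately unital'' means having a (two-sided) contractive approximate identity. $\otimes_h$ denotes the Haagerup tensor product of real operator spaces (defined as in the complex case, with $\mathbb{R}$ in place of $\mathbb{C}$). A map $u$ is completely contractive (completely isometric) if all its amplifications $u_n:[x_{ij}]\mapsto[u(x_{ij})]$ are contractive (isometric). All maps are real linear. *)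

(* Defs.v *)
From HB Require Import structures.
From mathcomp Require Import all_boot all_order all_algebra.
From mathcomp Require Import all_classical all_reals all_analysis.

Set Implicit Arguments.
Unset Strict Implicit.
Unset Printing Implicit Defensive.

Import Order.TTheory GRing.Theory Num.Theory.
Import numFieldNormedType.Exports.

Local Open Scope classical_set_scope.
Local Open Scope ring_scope.

(* The case n = 0 is included: for operator spaces the norm of M_0 is 0. *)
Definition mxnorms (R : realType) (V : Type) := forall n : nat, 'M[V]_n -> R.

Section MatrixNorms.
Variables (R : realType) (V W : Type) (nV : mxnorms R V) (nW : mxnorms R W).

Definition completely_contractive (f : V -> W) : Prop :=
  forall n (x : 'M[V]_n), nW (map_mx f x) <= nV x.

Definition completely_isometric (f : V -> W) : Prop :=
  forall n (x : 'M[V]_n), nW (map_mx f x) = nV x.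

End MatrixNorms.

Definition norm1 (R : realType) (V : Type) (nV : mxnorms R V) (v : V) : R :=
  nV 1%N (const_mx v).

(* M_{m,n}(V) carries the norm it inherits as a corner of M_{m+n}(V). *)
Definition rectnorm (R : realType) (V : zmodType) (nV : mxnorms R V)
    m n (x : 'M[V]_(m, n)) : R :=
  nV (m + n)%N (block_mx 0 x 0 0).

Record hilbertSpace (R : realType) := HilbertSpace {
  hilbert_sort :> completeNormedModType R;
  hilbert_dot : {dot hilbert_sort for idfun};
  hilbert_normE : forall x : hilbert_sort, `|x| ^+ 2 = hilbert_dot x x
}.

Section BoundedOperators.
Variables (R : realType) (H : hilbertSpace R).

Definition bounded_linear_pred : {pred (H -> H)} := fun T =>
  `[< linear T /\ exists M : R, forall x, `|T x| <= M * `|x| >].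

Record bop := Bop {
  bop_fun :> H -> H;
  _ : bop_fun \in bounded_linear_pred
}.

HB.instance Definition _ := [isSub for bop_fun].
HB.instance Definition _ := [Choice of bop by <:].

Lemma bounded_linear_submod_closed : submod_closed bounded_linear_pred.
Proof.
split=> [|c S T /asboolP[linS [M SM]] /asboolP[linT [N TN]]].
  apply/asboolP; split=> [k u v|]; first by rewrite scaler0 addr0.
  by exists 0 => x; rewrite normr0 mul0r.
apply/asboolP; split=> [k u v|].
  rewrite !fctE linS linT !scalerDr !scalerA (mulrC c k).
  by rewrite !addrA; congr (_ + _); rewrite -!addrA; congr (_ + _); rewrite addrC.
exists (`|c| * M + N) => x; rewrite !fctE mulrDl -mulrA.
rewrite (le_trans (ler_normD _ _))// lerD// normrZ.
by rewrite ler_wpM2l.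
Qed.

HB.instance Definition _ :=
  GRing.isSubmodClosed.Build R (H -> H) bounded_linear_pred
    bounded_linear_submod_closed.
HB.instance Definition _ := [SubChoice_isSubLmodule of bop by <:].

Definition l2norm n (v : 'cV[H]_n) : R :=
  Num.sqrt (\sum_(i < n) `|v i ord0| ^+ 2).

Definition mxop n (T : 'M[bop]_n) (v : 'cV[H]_n) : 'cV[H]_n :=
  \col_i \sum_(j < n) T i j (v j ord0).

(* M_n(B(H)) = B(H^n), where H^n has the l2norm above, not the sup norm that
   the library puts on column vectors. *)
Definition opnorm : mxnorms R bop := fun n T =>
  sup [set l2norm (mxop T v) | v in [set v | l2norm v <= 1]].

Definition norm_closed (S : set bop) : Prop :=
  forall T : bop,
    (forall e : R, 0 < e -> exists2 T', S T' & norm1 opnorm (T - T') < e) ->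
    S T.

End BoundedOperators.

Definition real_operator_space (R : realType) (A : normedModType R)
    (nA : mxnorms R A) : Prop :=
  (forall a : A, norm1 nA a = `|a|) /\
  exists (H : hilbertSpace R) (f : {linear A -> bop H}),
    completely_isometric nA (@opnorm R H) f /\ norm_closed (range f).

Section Tensor.
Variables (R : realType) (X Y : lmodType R).

Definition bilinear_form := {bilinear X -> Y -> R | *%R & *%R}.

(* X (x) Y is realised in the dual of the space of bilinear forms on X * Y, as
   the span of the evaluations x (x) y : phi |-> phi x y. *)
Definition tensor_pred : {pred (bilinear_form -> R^o)} := fun t =>
  `[< exists s : seq (X * Y),
        t = \sum_(xy <- s) (fun phi : bilinear_form => phi xy.1 xy.2 : R^o) >].

Record tensor := Tensor {
  tensor_fun :> bilinear_form -> R^o;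
  _ : tensor_fun \in tensor_pred
}.

HB.instance Definition _ := [isSub for tensor_fun].
HB.instance Definition _ := [Choice of tensor by <:].

Lemma tensor_submod_closed : submod_closed tensor_pred.
Proof.
split=> [|c t u /asboolP[s ->] /asboolP[r ->]].
  by apply/asboolP; exists [::]; rewrite big_nil.
apply/asboolP; exists ([seq (c *: xy.1, xy.2) | xy <- s] ++ r).
rewrite big_cat big_map; congr (_ + _).
rewrite scaler_sumr; apply: eq_bigr => -[x y] _ /=.
by apply/funext => phi; rewrite fctE linearZl_LR.
Qed.

HB.instance Definition _ :=
  GRing.isSubmodClosed.Build R (bilinear_form -> R^o) tensor_pred
    tensor_submod_closed.
HB.instance Definition _ := [SubChoice_isSubLmodule of tensor by <:].

Lemma tens_subproof (x : X) (y : Y) :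
  (fun phi : bilinear_form => phi x y : R^o) \in tensor_pred.
Proof. by apply/asboolP; exists [:: (x, y)]; rewrite big_seq1. Qed.

Definition tens (x : X) (y : Y) : tensor := Tensor (tens_subproof x y).

End Tensor.

Section Completion.
Variables (R : realType) (V : lmodType R) (nV : mxnorms R V).

Definition norm_cauchy (u : nat -> V) : Prop :=
  forall e : R, 0 < e -> exists N : nat, forall k l : nat,
    (N <= k)%N -> (N <= l)%N -> norm1 nV (u k - u l) < e.

Definition cauchy_class (u : nat -> V) : set (nat -> V) :=
  [set v | norm_cauchy v /\ norm1 nV (u k - v k) @[k --> \oo] --> (0 : R)].

Record completion := Completion {
  completion_class : set (nat -> V);
  completionP : exists2 u, norm_cauchy u & completion_class = cauchy_class u
}.

(* u is a Cauchy sequence in V with limit z in the completion. *)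
Definition converges_to (u : nat -> V) (z : completion) : Prop :=
  completion_class z u.

Definition completion_repr (z : completion) : nat -> V :=
  s2val (cid2 (completionP z)).

Definition completion_norm : mxnorms R completion := fun n z =>
  limn (fun k => nV (\matrix_(i, j) completion_repr (z i j) k)).

(* Linearity for the vector space operations of the completion, which are
   those induced by termwise operations on Cauchy sequences. *)
Definition completion_linear (W : lmodType R) (f : completion -> W) : Prop :=
  forall (c : R) (u v : nat -> V) (x y z : completion),
    converges_to u x -> converges_to v y ->
    converges_to (fun k => c *: u k + v k) z ->
    f z = c *: f x + f y.

End Completion.

Section Haagerup.
Variables (R : realType) (X Y : lmodType R).
Variables (nX : mxnorms R X) (nY : mxnorms R Y).

Definition odot n p (x : 'M[X]_(n, p)) (y : 'M[Y]_(p, n)) :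
    'M[tensor X Y]_n :=
  \matrix_(i, j) \sum_(k < p) tens (x i k) (y k j).

Definition haagerup_norm : mxnorms R (tensor X Y) := fun n t =>
  inf [set r : R | exists (p : nat) (x : 'M[X]_(n, p)) (y : 'M[Y]_(p, n)),
         t = odot x y /\ r = rectnorm nX x * rectnorm nY y].

Definition haagerup : Type := completion haagerup_norm.

Definition haagerup_mxnorm : mxnorms R haagerup :=
  completion_norm (nV := haagerup_norm).

Definition linearizes (W : lmodType R) (b : X -> Y -> W)
    (f : haagerup -> W) : Prop :=
  completion_linear f /\
  forall (x : X) (y : Y) (z : haagerup),
    converges_to (fun=> tens x y) z -> f z = b x y.

End Haagerup.

Section Algebras.
Variables (R : realType) (A : completeNormedModType R).
Variable mul : {bilinear A -> A -> A}.

Definition banach_algebra : Prop :=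
  associative mul /\ forall a b : A, `|mul a b| <= `|a| * `|b|.

Definition approximately_unital : Prop :=
  exists (I : Type) (le : I -> I -> Prop) (e : I -> A),
    [/\ inhabited I,
        (forall i, le i i) /\ (forall i j k, le i j -> le j k -> le i k),
        forall i j, exists k, le i k /\ le j k,
        forall i, `|e i| <= 1 &
        forall (a : A) (eps : R), 0 < eps -> exists i0, forall i, le i0 i ->
          `|mul (e i) a - a| < eps /\ `|mul a (e i) - a| < eps].

Variable nA : mxnorms R A.

Definition haagerup_multiplication_cc : Prop :=
  exists m : haagerup nA nA -> A,
    linearizes (mul : A -> A -> A) m /\
    completely_contractive (haagerup_mxnorm (nX := nA) (nY := nA)) nA m.

Definition mxalg_mul n (a b : 'M[A]_n) : 'M[A]_n :=
  \matrix_(i, j) \sum_(k < n) mul (a i k) (b k j).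

Definition matrix_banach_algebras : Prop :=
  forall n (a b : 'M[A]_n), nA (mxalg_mul a b) <= nA a * nA b.

Definition real_operator_algebra : Prop :=
  exists (H : hilbertSpace R) (pi : {linear A -> bop H}),
    completely_isometric nA (@opnorm R H) pi /\
    forall (a b : A) (x : H), pi (mul a b) x = pi a (pi b x).

End Algebras.

(* Main.v *)
(** The step from matrix Banach algebras to a Hilbert space representation is a
    GNS construction for columns. Embed [A] in [B(K)] and fix a vector [w] of
    [K^n]. A list of columns over [A] of length [n] is a matrix [X], whose cost
    at [w] is [|X^* w|^2]. Say that [X] dominates [Z] if replacing [X] by [Z]
    inside a larger matrix never increases the norm. Since the norms are
    submultiplicative and [A] has a contractive approximate identity, [X]
    dominates [X a] for every contractive matrix [a]. A Hahn-Banach argument on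
    formal differences of lists produces a function [s] on columns that
    is at least the cost at [w], at most [|w|^2] on contractive matrices, and
    monotone for domination. Monotonicity makes [s] a quadratic form, and makes
    right multiplication by contractive matrices contractive for [s]. Hence [A]
    acts completely contractively on the Hilbert space of [s]-bounded linear
    functionals by [(a phi)(v) = phi (v a)]; summing over all [n] and [w] makes
    the action completely isometric.

    For the Haagerup tensor product, a representation [t = x . y] can be
    rescaled so that [x] and [y] have the same norm, which gives the triangle
    inequality; the multiplication on the algebraic tensor product is therefore
    contractive and extends to the completion. *)

Require Import Defs.
From HB Require Import structures.
From mathcomp Require Import all_boot all_order all_algebra.
From mathcomp Require Import zify ring lra.
From mathcomp Require Import all_classical all_reals all_analysis.
Import numFieldNormedType.Exports.
Local Open Scope ring_scope.

Set Implicit Arguments.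
Unset Strict Implicit.
Unset Printing Implicit Defensive.

Import Order.TTheory GRing.Theory Num.Theory.
Local Open Scope classical_set_scope.

(** The embedding [f] into [B(K)] is only linear, so the cost of a list at one vector [w] may grow
    under right multiplication by a contraction; only the matrix norm, which tests all [w] at once,
    is controlled. The form [s] repairs this at a chosen [w]. The properties wanted of it are
    inequalities between sums over lists, and domination asks for replacement inside every larger
    matrix so that such inequalities can be added; they are then consistent as soon as they force no
    negative bound on the formal difference [0].

    Formal differences form only an abelian group, so the Hahn-Banach step is one for subadditive
    functions without scalars. Real scalars return afterwards: lists with the same cost at every [w]
    dominate each other, so [s] inherits the identities between costs, and a solution of Cauchy's
    equation bounded on an interval is linear.

    Norm bounds are stated throughout as [2 <x z, w> <= |z|^2 + C |w|^2]. In this form they can be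
    tested on vectors, summed over blocks and passed to entrywise limits without square roots or
    suprema. *)

Lemma le_infD (R : realType) (A B : set R) (c : R) : A !=set0 -> B !=set0 ->
  (forall a b, A a -> B b -> c <= a + b) -> c <= inf A + inf B.
Proof.
move=> A0 B0 AB; rewrite -lerBlDr; apply: lb_le_inf => // a Aa.
by rewrite lerBlDr -lerBlDl; apply: lb_le_inf => // b Bb; rewrite lerBlDl AB.
Qed.

(** * Hahn-Banach for subadditive functions on an abelian group *)

Section AdditiveMinorant.
Variables (R : realType) (M : zmodType).

Definition subadditive (p : M -> R) := forall u v, p (u + v) <= p u + p v.

Lemma subadditive_ge0 p : subadditive p -> 0 <= p 0.
Proof. by move=> ps; have := ps 0 0; rewrite addr0; lra. Qed.

Lemma subadditive_geN p u : subadditive p -> - p (- u) <= p u.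
Proof.
by move=> ps; have := subadditive_ge0 ps; have := ps u (- u); rewrite subrr; lra.
Qed.

Lemma subadditive_natmul p u n : subadditive p -> p (u *+ n.+1) <= p u *+ n.+1.
Proof.
move=> ps; elim: n => [|n IH]; first by rewrite !mulr1n.
by rewrite mulrS [leRHS]mulrS (le_trans (ps _ _))// lerD2l.
Qed.

(** Zorn's lemma for the reversed pointwise order. The pointwise infimum of a chain is finite
    because each member [t] satisfies [t u >= - p0 (- u)], and it is subadditive because of any two
    members of the chain one lies below the other. *)
Lemma minimal_subadditive (p0 : M -> R) : subadditive p0 ->
  exists p, [/\ subadditive p, forall u, p u <= p0 u &
    forall q, subadditive q -> (forall u, q u <= p u) -> q =1 p].
Proof.
move=> p0s; pose T := {p : M -> R | subadditive p /\ forall u, p u <= p0 u}.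
pose mk p (ps : subadditive p) (pp : forall u, p u <= p0 u) : T :=
  exist (fun p => subadditive p /\ forall u, p u <= p0 u) p (conj ps pp).
pose t0 := mk p0 p0s (fun u => lexx _).
pose le (s t : T) := `[< forall u, sval t u <= sval s u >].
have [||A Atot|[p [ps p_le]] pmin] := @ZL_preorder T t0 le.
- by move=> t; apply/asboolP.
- move=> r s t /asboolP rs /asboolP st; apply/asboolP => u.
  exact: le_trans (st u) (rs u).
- have [A0|/set0P[t1 At1]] := eqVneq A set0.
    by exists t0 => s; rewrite A0.
  pose S u := [set sval t u | t in A].
  have lbS u : has_inf (S u).
    split; first by exists (sval t1 u), t1.
    exists (- p0 (- u)) => _ [[t [ts tp]] _ <-] /=.
    by apply: le_trans (subadditive_geN u ts); rewrite lerN2.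
  have infS u t : A t -> inf (S u) <= sval t u.
    by move=> At; apply: ge_inf; [exact: (lbS u).2|exists t].
  have infs : subadditive (fun u => inf (S u)).
    move=> u v /=; apply: le_infD; [exact: (lbS u).1|exact: (lbS v).1|].
    move=> _ _ [t At <-] [r Ar <-].
    have [/asboolP tr|/asboolP rt] := Atot _ _ At Ar.
      rewrite (le_trans (infS _ _ Ar))// (le_trans ((svalP r).1 _ _))//.
      by rewrite lerD2r.
    rewrite (le_trans (infS _ _ At))// (le_trans ((svalP t).1 _ _))//.
    by rewrite lerD2l.
  have infp0 u : inf (S u) <= p0 u.
    exact: le_trans (infS u _ At1) ((svalP t1).2 u).
  exists (mk _ infs infp0) => s As; apply/asboolP => u /=.
  exact: infS.
exists p; split=> // q qs qp u.
have qp0 v : q v <= p0 v := le_trans (qp v) (p_le v).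
have /asboolP/(_ u)/= pq := pmin (mk q qs qp0) (asboolT qp).
by apply/le_anti; rewrite qp.
Qed.

(** A minimal subadditive [p] equals every subadditive function below it. Two such functions built
    from [p], a rescaled multiple and an infimum over translates, give [p (u *+ n) = p u *+ n] for
    positive [n] and [p (- x) = - p x]; additivity follows. *)
Lemma additive_minorant (p0 : M -> R) : subadditive p0 ->
  exists q : M -> R, {morph q : u v / u + v} /\ forall u, q u <= p0 u.
Proof.
move=> /minimal_subadditive[p [ps pp0 pmin]]; exists p; split=> //.
have pn u n : p (u *+ n.+1) = p u *+ n.+1.
  have n0 : (0 : R) < n.+1%:R by rewrite ltr0n.
  suff <- : p (u *+ n.+1) / n.+1%:R = p u by rewrite -[RHS]mulr_natr divfK// gt_eqF.
  apply: (pmin (fun u => p (u *+ n.+1) / n.+1%:R)) => [v w|v].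
    by rewrite -mulrDl ler_pM2r ?invr_gt0// mulrnDl ps.
  by rewrite ler_pdivrMr// mulr_natr subadditive_natmul.
have p00 : p 0 = 0 by have := pn 0 1%N; rewrite mul0rn mulr2n; lra.
(* Compare [p] with [u |-> inf_n (p (u + n x) - n p x)]: the term [n = 1] at [- x] is [- p x], and
   no term at [- x] is smaller, by subadditivity. *)
have pN x : p (- x) = - p x.
  pose S u := [set p (u + x *+ n) - p x *+ n | n in [set: nat]].
  have lbS u : has_inf (S u).
    split; first by exists (p (u + x *+ 0) - p x *+ 0), 0%N.
    exists (- p (- u)) => _ [n _ <-].
    have := ps (- u) (u + x *+ n); rewrite addKr.
    case: n => [|n]; first by rewrite !mulr0n addr0 p00; lra.
    by rewrite pn; lra.
  have infS u n : inf (S u) <= p (u + x *+ n) - p x *+ n.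
    by apply: ge_inf; [exact: (lbS u).2|exists n].
  have <- : inf (S (- x)) = p (- x).
    apply: (pmin (fun u => inf (S u))) => [u v|u]; last first.
      by have := infS u 0%N; rewrite !mulr0n addr0 subr0.
    apply: le_infD; [exact: (lbS u).1|exact: (lbS v).1|].
    move=> _ _ [n _ <-] [k _ <-]; rewrite (le_trans (infS _ (n + k)%N))//.
    have := ps (u + x *+ n) (v + x *+ k).
    by rewrite !mulrnDr (addrACA u) opprD; lra.
  apply: le_anti; apply/andP; split.
    by have := infS (- x) 1%N; rewrite !mulr1n addNr p00 sub0r.
  apply: lb_le_inf; first exact: (lbS _).1.
  move=> _ [n _ <-].
  have := ps (- x + x *+ n) x; rewrite addrAC addNr add0r.
  case: n => [|n]; first by rewrite !mulr0n addr0; lra.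
  by rewrite pn; lra.
move=> u v; apply/le_anti; rewrite ps/=.
by have := ps (u + v) (- v); rewrite pN addrK; lra.
Qed.

End AdditiveMinorant.

(** * The free abelian group on a type, as formal differences of lists *)

Section SignedMultisets.
Variable T : eqType.

Definition signed_count (X Y : seq T) : T -> int :=
  fun t => (count_mem t X)%:Z - (count_mem t Y)%:Z.

(** Counting multiplicities avoids a quotient of pairs of lists, and equality of formal differences
    becomes [perm_eq]. *)
Definition signed_pred : {pred (T -> int)} := fun u =>
  `[< exists X Y, u = signed_count X Y >].

Record signed := Signed {
  signed_fun :> T -> int;
  _ : signed_fun \in signed_pred
}.

HB.instance Definition _ := [isSub for signed_fun].
HB.instance Definition _ := [Choice of signed by <:].

Lemma signed_countB (X Y X' Y' : seq T) :
  signed_count X Y - signed_count X' Y' = signed_count (X ++ Y') (Y ++ X').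
Proof.
apply/funext => t; rewrite !fctE /signed_count !count_cat !PoszD.
by ring.
Qed.

Lemma signed_zmod_closed : zmod_closed signed_pred.
Proof.
split=> [|u v /asboolP[X [Y ->]] /asboolP[X' [Y' ->]]].
  by apply/asboolP; exists [::], [::]; apply/funext => t; rewrite /signed_count subrr.
by apply/asboolP; exists (X ++ Y'), (Y ++ X'); rewrite signed_countB.
Qed.

HB.instance Definition _ :=
  GRing.isZmodClosed.Build (T -> int) signed_pred signed_zmod_closed.
HB.instance Definition _ := [SubChoice_isSubZmodule of signed by <:].

Lemma signed_of_subproof X Y : signed_count X Y \in signed_pred.
Proof. by apply/asboolP; exists X, Y. Qed.

Definition signed_of X Y : signed := Signed (signed_of_subproof X Y).

Lemma signed_ofP (u : signed) : exists X Y, u = signed_of X Y.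
Proof.
have /asboolP[X [Y uE]] : signed_fun u \in signed_pred by exact: valP.
by exists X, Y; apply: val_inj.
Qed.

Lemma signed_ofB X Y X' Y' :
  signed_of X Y - signed_of X' Y' = signed_of (X ++ Y') (Y ++ X').
Proof. by apply: val_inj; rewrite raddfB /= signed_countB. Qed.

Lemma signed_of_eq X Y X' Y' :
  signed_of X Y = signed_of X' Y' -> perm_eq (X ++ Y') (Y ++ X').
Proof.
move=> /(congr1 val)/= XY; apply/allP => t _ /=.
have := congr1 (@^~ t) XY; rewrite /signed_count !count_cat => H.
by rewrite -eqz_nat !PoszD; apply/eqP; lia.
Qed.

End SignedMultisets.

(** * Hahn-Banach separation for the domination order on lists *)

Section CostMinorant.
Variables (R : realType) (T : eqType) (Theta : Type).
Variables (h : Theta -> T -> R) (N : Theta -> R) (th0 : Theta).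

Definition cost (X : seq T) th := \sum_(x <- X) h th x.

Definition cost_le X C := forall th, cost X th <= C * N th.

Definition dominates X Z :=
  forall Y C, cost_le (X ++ Y) C -> cost_le (Z ++ Y) C.

Hypothesis h_ge0 : forall th x, 0 <= h th x.
Hypothesis h_bounded : forall x, exists C, cost_le [:: x] C.

Lemma cost_cat X Y th : cost (X ++ Y) th = cost X th + cost Y th.
Proof. by rewrite /cost big_cat. Qed.

Lemma cost_ge0 X th : 0 <= cost X th.
Proof. exact: sumr_ge0. Qed.

Lemma cost_nseq X n th : cost (flatten (nseq n X)) th = cost X th *+ n.
Proof.
elim: n => [|n IH] /=; first by rewrite /cost big_nil mulr0n.
by rewrite cost_cat IH mulrS.
Qed.

Lemma cost_bounded X : exists C, cost_le X C.
Proof.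
elim: X => [|x X [C XC]]; first by exists 0 => th; rewrite /cost big_nil mul0r.
have [D xD] := h_bounded x; exists (D + C) => th.
by rewrite -cat1s cost_cat mulrDl lerD.
Qed.

Lemma dominates_cost X Z X' Z' : cost X =1 cost X' -> cost Z =1 cost Z' ->
  dominates X Z -> dominates X' Z'.
Proof.
move=> XX ZZ XZ Y C XYC th; rewrite cost_cat -ZZ -cost_cat; apply: XZ => th'.
by rewrite cost_cat XX -cost_cat.
Qed.

(** Replace [X] by [Z] with [X'] as part of the context, then [X'] by [Z'] with [Z] as part of the
    context. *)
Lemma dominates_cat X Z X' Z' : dominates X Z -> dominates X' Z' ->
  dominates (X ++ X') (Z ++ Z').
Proof.
move=> XZ XZ' Y C bX th.
have b1 : cost_le (Z ++ X' ++ Y) C by apply: XZ; rewrite catA.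
have /(_ th) : cost_le (Z' ++ Z ++ Y) C.
  apply: XZ' => th'; have := b1 th'; rewrite !cost_cat; lra.
by rewrite !cost_cat; lra.
Qed.

Lemma dominates_trans X Y Z : dominates X Y -> dominates Y Z -> dominates X Z.
Proof. by move=> XY YZ W C /XY/YZ. Qed.

Lemma dominates_refl X : dominates X X.
Proof. by []. Qed.

Lemma dominates_catl X Y : dominates (X ++ Y) X.
Proof.
move=> W C b th; have := b th; have := cost_ge0 Y th; rewrite !cost_cat; lra.
Qed.

(* Iterating the domination [n] times multiplies [y] and [c] by [n] but leaves
   a single [x], whose cost is negligible for large [n]. *)
Lemma dominates_cancel c x y C : cost_le c C ->
  dominates (c ++ x) (x ++ y) -> cost y th0 <= C * N th0.
Proof.
move=> cC cx.
have iter n : dominates (flatten (nseq n c) ++ x) (x ++ flatten (nseq n y)).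
  elim: n => [|n IH] /=; first by rewrite cats0.
  have := dominates_cat (@dominates_refl c) IH.
  have := dominates_cat cx (@dominates_refl (flatten (nseq n y))).
  rewrite -!catA => d1 d2; exact: dominates_trans d2 d1.
have [D xD] := cost_bounded x.
have bd n : (cost y th0 - C * N th0) *+ n <= D * N th0.
  have /(_ th0) : cost_le ((x ++ flatten (nseq n y)) ++ [::]) (C *+ n + D).
    apply: iter => th; rewrite !cost_cat cost_nseq.
    have := xD th; have : cost c th *+ n <= (C * N th) *+ n by exact: ler_wMn2r.
    by rewrite mulrDl mulrnAl [cost [::] _]/cost big_nil; lra.
  rewrite !cost_cat cost_nseq [cost [::] _]/cost big_nil mulrDl mulrnAl mulrnBl.
  by have := cost_ge0 x th0; lra.
rewrite leNgt; apply/negP; rewrite -subr_gt0 => lt0.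
have := bd (Num.truncn (D * N th0 / (cost y th0 - C * N th0))).+1.
rewrite -mulr_natl -ler_pdivlMr// => /(lt_le_trans (truncnS_gt _)).
by rewrite ltxx.
Qed.

(** The upper bounds that the wanted properties of [s] force on formal differences: with [s] summed
    over lists, domination gives [s X + s x + s y <= s c + s x + s Y], and then [s c <= C * N th0]
    and [cost y th0 <= s y] bound [s X - s Y]. *)
Let values (u : signed T) (r : R) := exists X Y c x y C,
  [/\ u = signed_of X Y, cost_le c C, dominates (c ++ x ++ Y) (X ++ x ++ y) &
     r = C * N th0 - cost y th0].

Let valuesD u v r s : values u r -> values v s -> values (u + v) (r + s).
Proof.
move=> [X [Y [c [x [y [C [-> cC d ->]]]]]]] [X' [Y' [c' [x' [y' [C' [-> cC' d' ->]]]]]]].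
exists (X ++ X'), (Y ++ Y'), (c ++ c'), (x ++ x'), (y ++ y'), (C + C'); split.
- rewrite -[signed_of X' Y']opprK.
  have -> : - signed_of X' Y' = signed_of Y' X'.
    by rewrite -sub0r; have := signed_ofB [::] [::] X' Y' => <-; congr (_ - _); apply: val_inj.
  by rewrite signed_ofB.
- by move=> th; rewrite cost_cat mulrDl lerD.
- apply: dominates_cost (dominates_cat d d') => th; rewrite !cost_cat; lra.
- by rewrite cost_cat; lra.
Qed.

(** Consistency of these bounds. If the difference is zero then [Y] is a permutation of [X], so it
    joins [x] as a part common to both sides, which [dominates_cancel] removes. Applied to [u - u]
    this bounds [values u] from below. *)
Let values0 r : values 0 r -> 0 <= r.
Proof.
move=> [X [Y [c [x [y [C [/esym XY cC d ->]]]]]]].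
have /signed_of_eq : signed_of X Y = signed_of [::] [::].
  by rewrite XY; apply: val_inj.
rewrite !cats0 => /= XYp; rewrite subr_ge0.
apply: (dominates_cancel (x := x ++ Y) cC); apply: dominates_cost d => // th.
by rewrite !cost_cat /cost (perm_big _ XYp)/=; lra.
Qed.

Let values_neq0 u : exists r, values u r.
Proof.
have [X [Y ->]] := signed_ofP u; have [C XC] := cost_bounded X.
exists (C * N th0 - cost [::] th0), X, Y, X, [::], [::], C; split=> //=.
by rewrite cats0; exact: dominates_catl.
Qed.

(** The infimum of [values u] is subadditive because [values] is closed under addition; an additive
    [q] below it defines [s] on singletons. Each of the three properties is one bound in [values]:
    [y = [:: t]] at the negative of [t], [c = X] at [X], and empty witnesses at [Z - X]. *)
Lemma cost_minorant : exists s : T -> R,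
  [/\ forall t, h th0 t <= s t,
      forall X C, cost_le X C -> \sum_(x <- X) s x <= C * N th0 &
      forall X Z, dominates X Z -> \sum_(z <- Z) s z <= \sum_(x <- X) s x].
Proof.
have inf_values u : has_inf (values u).
  split; first exact: values_neq0.
  have [s vs] := values_neq0 (- u); exists (- s) => r vr.
  by have := values0 (_ : values 0 (r + s)); rewrite -(subrr u) => /(_ (valuesD vr vs)); lra.
have subv : subadditive (fun u => inf (values u)).
  move=> u v /=; apply: le_infD; [exact: values_neq0..|] => r s ur vs.
  by apply: ge_inf; [exact: (inf_values _).2|exact: valuesD].
have [q [qD q_le]] := additive_minorant subv.
have q0 : q 0 = 0 by have := qD 0 0; rewrite addr0; lra.
have qv u r : values u r -> q u <= r.
  by move=> ur; apply: le_trans (q_le u) (ge_inf (inf_values u).2 ur).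
pose s t := q (signed_of [:: t] [::]).
have sE X : q (signed_of X [::]) = \sum_(x <- X) s x.
  elim: X => [|x X IH]; first by rewrite big_nil -[RHS]q0; congr q; apply: val_inj.
  rewrite big_cons -IH -qD; congr q; apply: val_inj; rewrite raddfD /=.
  by apply/funext => t; rewrite !fctE /signed_count/=; lia.
have qB X Y : q (signed_of X Y) = \sum_(x <- X) s x - \sum_(x <- Y) s x.
  rewrite -!sE -[LHS]addr0 -[in LHS](subrr (q (signed_of Y [::]))) addrA; congr (_ - _).
  rewrite -qD; congr q; apply: val_inj; rewrite raddfD /=.
  by apply/funext => t; rewrite !fctE /signed_count/=; lia.
exists s; split=> [t|X C XC|X Z XZ].
- have /qv : values (signed_of [::] [:: t]) (0 * N th0 - cost [:: t] th0).
    exists [::], [:: t], [::], [::], [:: t], 0; split=> //.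
    by move=> th; rewrite /cost big_nil mul0r.
  by rewrite qB big_nil /cost !big_seq1; lra.
- have /qv : values (signed_of X [::]) (C * N th0 - cost [::] th0).
    by exists X, [::], X, [::], [::], C; split.
  by rewrite qB big_nil /cost big_nil; lra.
- have /qv : values (signed_of Z X) (0 * N th0 - cost [::] th0).
    exists Z, X, [::], [::], [::], 0; split=> //=; last by rewrite cats0.
    by move=> th; rewrite /cost big_nil mul0r.
  by rewrite qB /cost big_nil; lra.
Qed.

End CostMinorant.

(** The deviation [d] from linearity is additive and vanishes at [1], so its bound on [[0, 1]] holds
    on the whole half-line; [d (n t) = n d t] then forces [d t = 0]. *)
Lemma additive_bounded_linear (R : realType) (f : R -> R) (K : R) :
  (forall a b, 0 <= a -> 0 <= b -> f (a + b) = f a + f b) ->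
  (forall t, 0 <= t <= 1 -> `|f t| <= K) ->
  forall t, 0 <= t -> f t = t * f 1.
Proof.
move=> fD fK t t0; pose d u := f u - u * f 1.
have dD a b : 0 <= a -> 0 <= b -> d (a + b) = d a + d b.
  by move=> a0 b0; rewrite /d fD//; ring.
have dn n a : 0 <= a -> d (a *+ n) = d a *+ n.
  move=> a0; elim: n => [|n IH].
    by have := @dD 0 0 (lexx _) (lexx _); rewrite !mulr0n addr0; lra.
  by rewrite !mulrS dD ?mulrn_wge0// IH.
have d1 : d 1 = 0 by rewrite /d mul1r subrr.
have dK u : 0 <= u -> `|d u| <= K + `|f 1|.
  move=> u0; pose m := Num.truncn u.
  have /andP[mu um] := truncn_itv u0.
  have -> : u = (u - m%:R) + 1 *+ m by rewrite subrK.
  rewrite dD ?subr_ge0// dn// d1 mul0rn addr0 (le_trans (ler_normB _ _))// lerD//.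
    by apply: fK; move: um; rewrite -/m -natr1; lra.
  rewrite normrM ler_piMl// ger0_norm ?subr_ge0//.
  by move: um; rewrite -/m -natr1; lra.
suff d0 : d t = 0 by move: d0; rewrite /d; lra.
apply/eqP; rewrite -normr_le0 leNgt; apply/negP => dt0.
have := dK _ (mulrn_wge0 (Num.truncn ((K + `|f 1|) / `|d t|)).+1 t0).
rewrite dn// normrMn -mulr_natl -ler_pdivlMr// => /(lt_le_trans (truncnS_gt _)).
by rewrite ltxx.
Qed.

(** The square of a Hilbert seminorm. The parallelogram law is taken instead of a bilinear form
    because [s] is obtained only as a function on vectors. *)
Record qform (R : realType) (V : lmodType R) := QForm {
  qf :> V -> R;
  qf_ge0 : forall v, 0 <= qf v;
  qfZ : forall t v, qf (t *: v) = t ^+ 2 * qf v;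
  qf_parallelogram : forall u v, qf (u + v) + qf (u - v) = 2 * qf u + 2 * qf v
}.

(** * Conjugates of quadratic forms *)

Section Conjugate.
Variables (R : realType) (V : lmodType R) (s : qform V).
Implicit Types phi psi : V -> R.

(** For linear [phi] this says [phi v ^+ 2 <= C * s v], as optimising over multiples of [v]
    shows. *)
Definition conj_bounded phi C := forall v, 2 * phi v - s v <= C.

(* The squared norm of [phi] as a functional on the seminormed space
   [(V, sqrt s)]. *)
Definition conjq phi := sup (range (fun v => 2 * phi v - s v)).

Lemma qf0 : s 0 = 0.
Proof. by rewrite -(scale0r 0) qfZ expr0n mul0r. Qed.

Lemma conjq_ub phi C v : conj_bounded phi C -> 2 * phi v - s v <= conjq phi.
Proof.
by move=> b; apply: ub_le_sup; [exists C => _ [w _ <-]|exists v].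
Qed.

Lemma conjq_le phi C : conj_bounded phi C -> conjq phi <= C.
Proof.
move=> b; apply: ge_sup; first by exists (2 * phi 0 - s 0), 0.
by move=> _ [w _ <-].
Qed.

Lemma scalar0 phi : scalar phi -> phi 0 = 0.
Proof. by move=> l; have := l (-1) 0 0; rewrite scaler0 addr0 mulN1r addNr. Qed.

Lemma scalarZ phi t v : scalar phi -> phi (t *: v) = t * phi v.
Proof. by move=> l; have := l t v 0; rewrite addr0 scalar0// addr0. Qed.

Lemma scalarD phi u v : scalar phi -> phi (u + v) = phi u + phi v.
Proof. by move=> l; have := l 1 u v; rewrite scale1r mul1r. Qed.

Lemma scalarN phi v : scalar phi -> phi (- v) = - phi v.
Proof. by move=> l; rewrite -scaleN1r scalarZ// mulN1r. Qed.

Lemma scalar_sum phi (I : finType) (F : I -> V) :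
  scalar phi -> phi (\sum_i F i) = \sum_i phi (F i).
Proof.
move=> l; elim/big_ind2 : _ => [|u a v b <- <-|//]; first exact: scalar0.
exact: scalarD.
Qed.

Lemma conjq_ge0 phi C : scalar phi -> conj_bounded phi C -> 0 <= conjq phi.
Proof.
by move=> l b; have := conjq_ub 0 b; rewrite scalar0// qf0 mulr0 subr0.
Qed.

Lemma conj_boundedZ phi C t : scalar phi -> conj_bounded phi C -> t != 0 ->
  conj_bounded (fun v => t * phi v) (t ^+ 2 * C).
Proof.
move=> l b t0 v; have := b (t^-1 *: v); rewrite qfZ (scalarZ _ _ l) => bv.
have -> : 2 * (t * phi v) - s v =
    t ^+ 2 * (2 * (t^-1 * phi v) - t^-1 ^+ 2 * s v) by field.
by rewrite ler_wpM2l// sqr_ge0.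
Qed.

Lemma conjqZ phi C t : scalar phi -> conj_bounded phi C ->
  conjq (fun v => t * phi v) = t ^+ 2 * conjq phi.
Proof.
move=> l b; have b' : conj_bounded phi (conjq phi) by move=> v; exact: conjq_ub b.
have [->|t0] := eqVneq t 0.
  rewrite expr0n mul0r; apply/le_anti/andP; split.
    by apply: conjq_le => v; rewrite mul0r mulr0 sub0r oppr_le0 qf_ge0.
  apply: (@conjq_ge0 _ 0).
    by move=> a u v /=; rewrite !mul0r mulr0 addr0.
  by move=> v; rewrite mul0r mulr0 sub0r oppr_le0 qf_ge0.
have bt := conj_boundedZ l b' t0; apply/le_anti/andP; split; first exact: conjq_le.
rewrite -ler_pdivlMl ?exprn_even_gt0//.
apply: conjq_le => v; rewrite ler_pdivlMl ?exprn_even_gt0//.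
have := conjq_ub (t *: v) bt; rewrite qfZ (scalarZ _ _ l); apply: le_trans.
by rewrite le_eqVlt; apply/orP; left; apply/eqP; ring.
Qed.

Lemma qf_half v : s (2^-1 *: v) = s v / 4.
Proof. by rewrite qfZ; field. Qed.

Lemma scalar_comb phi psi t : scalar phi -> scalar psi ->
  scalar (fun v => t * phi v + psi v).
Proof. by move=> l l' a u v; rewrite l l' !mulrDr /=; ring. Qed.

Lemma conj_boundedD phi psi C D : scalar phi -> scalar psi ->
  conj_bounded phi C -> conj_bounded psi D ->
  conj_bounded (fun v => phi v + psi v) (2 * C + 2 * D).
Proof.
move=> l l' b b' v; have := b (2^-1 *: v); have := b' (2^-1 *: v).
by rewrite !qf_half (scalarZ _ _ l) (scalarZ _ _ l'); lra.
Qed.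

Lemma conj_boundedB phi psi C D : scalar phi -> scalar psi ->
  conj_bounded phi C -> conj_bounded psi D ->
  conj_bounded (fun v => phi v - psi v) (2 * C + 2 * D).
Proof.
move=> l l' b b' v; have := b (2^-1 *: v); have := b' (- (2^-1 *: v)).
by rewrite (scalarN _ l') -scaleN1r qfZ !qf_half (scalarZ _ _ l) (scalarZ _ _ l'); lra.
Qed.

(** The pair [u], [v] is tested through the half sum [(u + v) / 2] for [phi] and the half difference
    for [psi]; the parallelogram law of [s] matches the quadratic terms. *)
Lemma conjq_parallelogram_le phi psi C D : scalar phi -> scalar psi ->
  conj_bounded phi C -> conj_bounded psi D ->
  conjq (fun v => phi v + psi v) + conjq (fun v => phi v - psi v) <=
  2 * conjq phi + 2 * conjq psi.
Proof.
move=> l l' b b'; rewrite -lerBrDr; apply: conjq_le => u.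
rewrite lerBrDr addrC -lerBrDr; apply: conjq_le => v; rewrite lerBrDr.
have := conjq_ub (2^-1 *: (u + v)) b; have := conjq_ub (2^-1 *: (u - v)) b'.
rewrite !qf_half (scalarZ _ _ l) (scalarZ _ _ l') (scalarD _ _ l) (scalarD _ _ l') (scalarN _ l').
by have := qf_parallelogram s u v; lra.
Qed.

(** The converse inequality is the same one for [phi + psi] and [phi - psi], whose sum and
    difference are [2 phi] and [2 psi]. *)
Lemma conjq_parallelogram phi psi C D : scalar phi -> scalar psi ->
  conj_bounded phi C -> conj_bounded psi D ->
  conjq (fun v => phi v + psi v) + conjq (fun v => phi v - psi v) =
  2 * conjq phi + 2 * conjq psi.
Proof.
move=> l l' b b'; apply/le_anti/andP; split.
  exact: conjq_parallelogram_le b b'.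
have lD : scalar (fun v => phi v + psi v).
  by move=> a u v; rewrite l l' /=; ring.
have lB : scalar (fun v => phi v - psi v).
  by move=> a u v; rewrite l l' /=; ring.
have := conjq_parallelogram_le lD lB (conj_boundedD l l' b b') (conj_boundedB l l' b b').
have -> : (fun v => phi v + psi v + (phi v - psi v)) = (fun v => 2 * phi v).
  by apply/funext => v; ring.
have -> : (fun v => phi v + psi v - (phi v - psi v)) = (fun v => 2 * psi v).
  by apply/funext => v; ring.
by rewrite (conjqZ _ l b) (conjqZ _ l' b'); lra.
Qed.

Lemma conj_bounded0_eq0 phi : scalar phi -> conj_bounded phi 0 -> phi =1 \0.
Proof.
move=> l b v /=; apply/eqP; apply: contraT => p0.
(* The denominator [1 + s v] stands in for [s v], which may vanish. *)
have := b ((phi v / (1 + s v)) *: v); rewrite qfZ (scalarZ _ _ l).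
have s0 := qf_ge0 s v; have s1 : 0 < 1 + s v by lra.
have -> : 2 * (phi v / (1 + s v) * phi v) - (phi v / (1 + s v)) ^+ 2 * s v =
  (phi v / (1 + s v)) ^+ 2 * (2 + s v) by field; lra.
rewrite leNgt mulr_gt0//; last lra.
by rewrite exprn_even_gt0//= mulf_neq0// invr_eq0 gt_eqF.
Qed.

(* With [l = a / (a + b)], split [s v] as [l * s v + (1 - l) * s v]. *)
Lemma conj_bounded_triangle phi psi a b : scalar phi -> scalar psi ->
  0 < a -> 0 < b -> conj_bounded phi (a ^+ 2) -> conj_bounded psi (b ^+ 2) ->
  conj_bounded (fun v => phi v + psi v) ((a + b) ^+ 2).
Proof.
move=> l l' a0 b0 pa pb v; have ab : 0 < a + b by lra.
have := pa ((a / (a + b)) *: v); have := pb ((b / (a + b)) *: v).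
rewrite !qfZ (scalarZ _ _ l) (scalarZ _ _ l') => p2 p1.
have -> : 2 * (phi v + psi v) - s v =
  (a + b) / a * (2 * (a / (a + b) * phi v) - (a / (a + b)) ^+ 2 * s v) +
  (a + b) / b * (2 * (b / (a + b) * psi v) - (b / (a + b)) ^+ 2 * s v).
  by field; lra.
have -> : (a + b) ^+ 2 = (a + b) / a * a ^+ 2 + (a + b) / b * b ^+ 2.
  by field; lra.
by rewrite lerD// ler_wpM2l// divr_ge0// ltW.
Qed.

Lemma conjq_triangle phi psi C D : scalar phi -> scalar psi ->
  conj_bounded phi C -> conj_bounded psi D ->
  Num.sqrt (conjq (fun v => phi v + psi v)) <=
  Num.sqrt (conjq phi) + Num.sqrt (conjq psi).
Proof.
(* Adding [e / 2] makes both radii positive, as [conj_bounded_triangle] requires. *)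
move=> l l' b b'; apply/ler_addgt0Pr => e e0.
have p0 := conjq_ge0 l b; have q0 := conjq_ge0 l' b'.
have pe : 0 < Num.sqrt (conjq phi) + e / 2.
  by rewrite ltr_wpDl ?sqrtr_ge0//; lra.
have qe : 0 < Num.sqrt (conjq psi) + e / 2.
  by rewrite ltr_wpDl ?sqrtr_ge0//; lra.
have le_sq x : 0 <= x -> x <= (Num.sqrt x + e / 2) ^+ 2.
  move=> x0; rewrite -[leLHS]sqr_sqrtr// lerXn2r ?nnegrE ?sqrtr_ge0//; last lra.
  by rewrite addr_ge0 ?sqrtr_ge0//; lra.
have -> : Num.sqrt (conjq phi) + Num.sqrt (conjq psi) + e =
  (Num.sqrt (conjq phi) + e / 2) + (Num.sqrt (conjq psi) + e / 2) by field.
rewrite -[leRHS]ger0_norm -?sqrtr_sqr; last by rewrite addr_ge0// ltW.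
apply: ler_wsqrtr; apply/conjq_le/conj_bounded_triangle => // v.
  exact: le_trans (conjq_ub v b) (le_sq _ p0).
exact: le_trans (conjq_ub v b') (le_sq _ q0).
Qed.

End Conjugate.

(** * Jordan-von Neumann: an inner product from the parallelogram law *)

Section JordanVonNeumann.
Variables (R : realType) (H : normedModType R).
Hypothesis parallelogram : forall x y : H,
  `|x + y| ^+ 2 + `|x - y| ^+ 2 = 2 * `|x| ^+ 2 + 2 * `|y| ^+ 2.

Definition polar (x y : H) : R := (`|x + y| ^+ 2 - `|x - y| ^+ 2) / 4.

Lemma polarC x y : polar x y = polar y x.
Proof. by rewrite /polar (addrC x y) distrC. Qed.

Lemma polarNl x y : polar (- x) y = - polar x y.
Proof.
have -> : polar (- x) y = (`|x - y| ^+ 2 - `|x + y| ^+ 2) / 4.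
  by rewrite /polar -opprD normrN [- x + y]addrC distrC.
by rewrite /polar; field.
Qed.

(** In [e1 - e2 + e3 - e4] the norms in which [x] and [y] carry opposite signs cancel in pairs. *)
Lemma polarDl x y z : polar (x + y) z = polar x z + polar y z.
Proof.
have e1 := parallelogram (x + z) y; have e2 := parallelogram (x - z) y.
have e3 := parallelogram (y + z) x; have e4 := parallelogram (y - z) x.
have h1 : `|x + z - y| = `|y - z - x|.
  by rewrite distrC opprD addrA addrAC.
have h2 : `|x - z - y| = `|y + z - x|.
  by rewrite -addrA -opprD distrC [z + y]addrC.
have h3 : x + z + y = x + y + z by rewrite addrAC.
have h4 : x - z + y = x + y - z by rewrite addrAC.
have h5 : y + z + x = x + y + z by rewrite addrAC [y + x]addrC.
have h6 : y - z + x = x + y - z by rewrite addrAC [y + x]addrC.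
rewrite h1 h3 in e1; rewrite h2 h4 in e2; rewrite h5 in e3; rewrite h6 in e4.
by rewrite /polar; lra.
Qed.

Lemma polarxx x : polar x x = `|x| ^+ 2.
Proof.
rewrite /polar subrr normr0 expr0n subr0 -mulr2n -scaler_nat normrZ exprMn.
by rewrite normr_nat; field.
Qed.

(** Additivity in [t], and the bound that the parallelogram law gives for [0 <= t <= 1], reduce real
    homogeneity to Cauchy's equation. *)
Lemma polarZl t x y : polar (t *: x) y = t * polar x y.
Proof.
have pos u : 0 <= u -> polar (u *: x) y = u * polar x y.
  move=> u0.
  have H1 := @additive_bounded_linear R (fun u => polar (u *: x) y)
    (`|x| ^+ 2 + `|y| ^+ 2).
  rewrite H1 ?scale1r//; first by move=> a b _ _; rewrite scalerDl polarDl.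
  move=> a /andP[a0 a1]; have := parallelogram (a *: x) y.
  have : `|a *: x| ^+ 2 <= `|x| ^+ 2.
    rewrite lerXn2r ?nnegrE// normrZ ger0_norm//.
    by rewrite ler_piMl.
  have := sqr_ge0 `|a *: x + y|; have := sqr_ge0 `|a *: x - y|.
  by rewrite ler_norml /polar; lra.
have [t0|t0] := leP 0 t; first exact: pos.
rewrite -[t]opprK scaleNr polarNl pos ?mulNr//; lra.
Qed.

Lemma polar_zmod_morphisml y : zmod_morphism (polar ^~ y).
Proof. by move=> a b /=; rewrite polarDl polarNl. Qed.

Lemma polar_zmod_morphismr x : zmod_morphism (polar x).
Proof. by move=> a b /=; rewrite !(polarC x) polarDl polarNl. Qed.

Lemma polar_scalel y : scalable_for *%R (polar ^~ y).
Proof. by move=> t x /=; rewrite polarZl. Qed.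

Lemma polar_scaler x : scalable_for (idfun \; *%R) (polar x).
Proof. by move=> t y /=; rewrite !(polarC x) polarZl. Qed.

HB.instance Definition _ := isBilinear.Build R H H R *%R (idfun \; *%R) polar
  polar_zmod_morphisml polar_zmod_morphismr polar_scalel polar_scaler.

Lemma polar_hermitian x y : polar x y = (-1) ^+ false * idfun (polar y x).
Proof. by rewrite expr0 mul1r polarC. Qed.

HB.instance Definition _ :=
  isHermitianSesquilinear.Build R H false idfun polar polar_hermitian.

Lemma polar_gt0 x : x != 0 -> 0 < polar x x.
Proof. by move=> x0; rewrite polarxx exprn_gt0// normr_gt0. Qed.

HB.instance Definition _ := isDotProduct.Build R H polar polar_gt0.

Definition polar_dot : {dot H for idfun} := polar.

End JordanVonNeumann.

(** * The Hilbert space of functionals bounded for a quadratic form *)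

Section DualHilbertSpace.
Variables (R : realType) (V : lmodType R) (s : qform V).

(** Bounded functionals vanish on the null vectors of [s] and are complete as they stand, so neither
    a quotient nor a completion of [V] is formed. *)
Definition dual_pred : {pred (V -> R^o)} := fun phi =>
  `[< scalar (phi : V -> R) /\ exists C, conj_bounded s phi C >].

Record dual := Dual {
  dual_fun :> V -> R^o;
  _ : dual_fun \in dual_pred
}.

HB.instance Definition _ := [isSub for dual_fun].
HB.instance Definition _ := [Choice of dual by <:].

Lemma dual_submod_closed : submod_closed dual_pred.
Proof.
split=> [|c phi psi /asboolP[l [C b]] /asboolP[l' [D b']]]; apply/asboolP.
  split; first by move=> a u v; rewrite -[RHS]/(a * 0 + 0 : R) mulr0 addr0.
  by exists 0 => v; rewrite -[X in X - _]/(2 * 0 : R) mulr0 sub0r oppr_le0 qf_ge0.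
split; first exact: scalar_comb.
have [->|c0] := eqVneq c 0; first by exists D; rewrite scale0r add0r.
exists (2 * (c ^+ 2 * C) + 2 * D).
apply: (conj_boundedD _ _ (conj_boundedZ l b c0) b') => //.
by move=> a u v /=; rewrite l mulrDr mulrCA.
Qed.

HB.instance Definition _ :=
  GRing.isSubmodClosed.Build R (V -> R^o) dual_pred dual_submod_closed.
HB.instance Definition _ := [SubChoice_isSubLmodule of dual by <:].

Lemma dualP (phi : dual) : scalar (phi : V -> R) /\ exists C, conj_bounded s phi C.
Proof. by apply/asboolP; exact: (valP phi). Qed.

Lemma dualDE (phi psi : dual) : (phi + psi : dual) = (fun v => phi v + psi v) :> (V -> R).
Proof. by rewrite -[LHS]/(val (phi + psi)) raddfD. Qed.

Lemma dualBE (phi psi : dual) : (phi - psi : dual) = (fun v => phi v - psi v) :> (V -> R).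
Proof. by rewrite -[LHS]/(val (phi - psi)) raddfB. Qed.

Lemma dualZE c (phi : dual) : (c *: phi : dual) = (fun v => c * phi v) :> (V -> R).
Proof. by rewrite -[LHS]/(val (c *: phi)) linearZ. Qed.

Definition dual_norm (phi : dual) := Num.sqrt (conjq s phi).

Lemma dual_normD phi psi : dual_norm (phi + psi) <= dual_norm phi + dual_norm psi.
Proof.
have [l [C b]] := dualP phi; have [l' [D b']] := dualP psi.
by rewrite /dual_norm dualDE; exact: conjq_triangle b b'.
Qed.

Lemma dual_normZ c phi : dual_norm (c *: phi) = `|c| * dual_norm phi.
Proof.
have [l [C b]] := dualP phi.
by rewrite /dual_norm dualZE (conjqZ _ l b) sqrtrM ?sqr_ge0// sqrtr_sqr.
Qed.

Lemma dual_norm_eq0 phi : dual_norm phi = 0 -> phi = 0.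
Proof.
have [l [C b]] := dualP phi; move=> /eqP; rewrite sqrtr_eq0 => p0.
apply: val_inj; apply/funext => v /=.
apply: conj_bounded0_eq0 (l) _ v => v; exact: le_trans (conjq_ub v b) p0.
Qed.

HB.instance Definition _ :=
  Lmodule_isNormed.Build R dual dual_normD dual_normZ dual_norm_eq0.

Lemma dual_normE (phi : dual) : `|phi| = Num.sqrt (conjq s phi).
Proof. by []. Qed.

Lemma dual_norm_sqr (phi : dual) : `|phi| ^+ 2 = conjq s phi.
Proof.
have [l [C b]] := dualP phi.
by rewrite dual_normE sqr_sqrtr//; exact: conjq_ge0 b.
Qed.

Lemma dual_le_norm (phi : dual) v : 2 * phi v - s v <= `|phi| ^+ 2.
Proof. by have [l [C b]] := dualP phi; rewrite dual_norm_sqr; exact: conjq_ub b. Qed.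

Lemma dual_norm_le (phi : dual) C : 0 <= C ->
  (forall v, 2 * phi v - s v <= C ^+ 2) -> `|phi| <= C.
Proof.
move=> C0 b; rewrite -ler_sqr ?nnegrE//.
by rewrite dual_norm_sqr; exact: conjq_le.
Qed.

(** Test [dual_le_norm] at [v] and [- v], scaled by the norm of [phi]. The factor [1 + s v], cruder
    than a square root, is enough for evaluation at [v] to be continuous. *)
Lemma dual_eval_le (phi : dual) v : `|phi v| <= `|phi| * (1 + s v).
Proof.
have [l [C b]] := dualP phi; have [p0|p0] := eqVneq `|phi| 0.
  have /normr0_eq0 -> : `|phi| = 0 by [].
  by rewrite normr0 normr0 mul0r.
have r0 : 0 < `|phi| by rewrite lt_def p0 normr_ge0.
have h w : 2 * phi w <= `|phi| * (1 + s w).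
  have := dual_le_norm phi (`|phi| *: w); rewrite qfZ (scalarZ _ _ l) => h.
  rewrite -(ler_pM2l r0); lra.
have := h v; have := h (- v); rewrite (scalarN _ l).
rewrite -scaleN1r qfZ sqrrN expr1n mul1r => h1 h2.
have : 0 <= `|phi| * (1 + s v) by rewrite mulr_ge0// addr_ge0// qf_ge0.
by rewrite ler_norml; lra.
Qed.

Lemma dual_parallelogram (phi psi : dual) :
  `|phi + psi| ^+ 2 + `|phi - psi| ^+ 2 = 2 * `|phi| ^+ 2 + 2 * `|psi| ^+ 2.
Proof.
have [l [C b]] := dualP phi; have [l' [D b']] := dualP psi.
by rewrite !dual_norm_sqr dualDE dualBE; exact: conjq_parallelogram b b'.
Qed.

(** The limit is taken pointwise; it is a norm limit because the bound
    [2 * (phi v - psi v) - s v <= e ^+ 2], uniform in [v], survives the limit in [psi] at each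
    [v]. *)
Lemma dual_complete (F : set_system dual) :
  ProperFilter F -> cauchy F -> cvg F.
Proof.
move=> FF Fc.
have Fv v : cvg ((fun phi : dual => phi v : R) @ F).
  apply/cauchy_cvgP/cauchyP => e e0.
  have s1 : 0 < 1 + s v by rewrite ltr_wpDr ?qf_ge0.
  have /cauchyP/(_ (e / (1 + s v)))[|x Fx] := Fc; first by rewrite divr_gt0.
  exists (x v); suff : F [set y | ball (x v) e (y v : R)] by [].
  apply: (@filterS _ F _ _ _ _ Fx) => y; rewrite -!ball_normE/= => xy.
  have -> : x v - y v = (x - y) v by rewrite dualBE.
  by rewrite (le_lt_trans (dual_eval_le _ _))// -ltr_pdivlMr.
pose L v := lim ((fun phi : dual => phi v : R) @ F).
have LL : scalar L.
  move=> a u v; apply: cvg_lim => //.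
  have -> : (fun phi : dual => phi (a *: u + v) : R) =
      (fun phi : dual => a * phi u + phi v).
    by apply/funext => phi; have [l _] := dualP phi; rewrite l.
  by apply: cvgD; [apply: cvgMl_tmp; exact: Fv|exact: Fv].
have nearL e : 0 < e -> F [set phi : dual | forall v,
    2 * (phi v - L v) - s v <= e ^+ 2].
  move=> e0; have /cauchyP/(_ (e / 2))[|x Fx] := Fc; first by rewrite divr_gt0.
  apply: (@filterS _ F _ _ _ _ Fx) => phi xphi v.
  have c : (fun psi : dual => 2 * (phi v - psi v) - s v : R) @ F -->
      (2 * (phi v - L v) - s v : R).
    apply: cvgB; last exact: cvg_cst.
    by apply: cvgMl_tmp; apply: cvgB; [exact: cvg_cst|exact: Fv].
  apply: (cvgr_to_le c); apply: (@filterS _ F _ _ _ _ Fx) => psi xpsi.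
  have -> : phi v - psi v = (phi - psi) v by rewrite dualBE.
  apply: le_trans (dual_le_norm _ _) _; rewrite lerXn2r ?nnegrE ?(ltW e0)//.
  move: xphi xpsi; rewrite -!ball_normE/= => xphi xpsi.
  rewrite [e]splitr; apply: le_trans (ler_distD x _ _) _.
  by rewrite lerD ?ltW// distrC.
have [phi /= phiL] := filter_ex (nearL 1 ltr01).
have [l [C b]] := dualP phi.
have LP : (L : V -> R^o) \in dual_pred.
  apply/asboolP; split=> //; exists (2 * C + 2 * 1 ^+ 2) => v.
  have -> : L v = phi v - (phi v - L v) by rewrite opprB addrC subrK.
  apply: (conj_boundedB l _ b phiL) => a u w.
  by rewrite l LL /= mulrBr; ring.
apply/cvg_ex; exists (Dual LP : dual); apply/cvgrPdist_le => e e0.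
apply: (@filterS _ F _ _ _ _ (nearL e e0)) => psi /= psiL.
by rewrite distrC; apply: dual_norm_le => [|v]; [exact: ltW|rewrite dualBE; exact: psiL].
Qed.

HB.instance Definition _ := Uniform_isComplete.Build dual dual_complete.

Lemma dual_dotE (phi : dual) : `|phi| ^+ 2 = polar_dot dual_parallelogram phi phi.
Proof. by rewrite -polarxx. Qed.

Definition dual_space : hilbertSpace R := HilbertSpace dual_dotE.

Lemma dual_spaceE t (phi psi : dual_space) v :
  dual_fun (t *: phi + psi) v = t * dual_fun phi v + dual_fun psi v.
Proof.
by rewrite -[LHS]/(dual_fun ((t *: phi : dual) + (psi : dual)) v) dualDE dualZE.
Qed.

Lemma dual_space_sumE (I : finType) (F : I -> dual_space) v :
  dual_fun (\sum_i F i) v = \sum_i dual_fun (F i) v.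
Proof.
apply: (big_morph (fun phi : dual_space => dual_fun phi v)) => [phi psi|//].
by rewrite -[phi]scale1r dual_spaceE mul1r scale1r.
Qed.

Lemma dual_space_normE (phi : dual_space) : `|phi| ^+ 2 = conjq s (dual_fun phi).
Proof. exact: dual_norm_sqr. Qed.

End DualHilbertSpace.

Section HilbertDot.
Variables (R : realType) (H : hilbertSpace R).
Implicit Types x y z : H.
Local Notation dot := (hilbert_dot H).

Lemma dotDl x y z : dot (x + y) z = dot x z + dot y z.
Proof. exact: linearDl. Qed.

Lemma dotDr x y z : dot x (y + z) = dot x y + dot x z.
Proof. exact: linearDr. Qed.

Lemma dotZl t x y : dot (t *: x) y = t * dot x y.
Proof. exact: linearZl_LR. Qed.

Lemma dotZr t x y : dot x (t *: y) = t * dot x y.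
Proof. exact: linearZr_LR. Qed.

Lemma dotC x y : dot x y = dot y x.
Proof. by rewrite hermC expr0 mul1r. Qed.

Lemma dot0l x : dot 0 x = 0.
Proof. by rewrite -(scale0r x) dotZl mul0r. Qed.

Lemma dot0r x : dot x 0 = 0.
Proof. by rewrite dotC dot0l. Qed.

Lemma dotNl x y : dot (- x) y = - dot x y.
Proof. by rewrite -scaleN1r dotZl mulN1r. Qed.

Lemma dotNr x y : dot x (- y) = - dot x y.
Proof. by rewrite dotC dotNl dotC. Qed.

Lemma dot_suml (I : finType) (F : I -> H) y : dot (\sum_i F i) y = \sum_i dot (F i) y.
Proof. by apply: (big_morph (dot^~ y)) => [u v|]; rewrite ?dotDl ?dot0l. Qed.

Lemma normD_sqr x y : `|x + y| ^+ 2 = `|x| ^+ 2 + 2 * dot x y + `|y| ^+ 2.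
Proof. by rewrite !hilbert_normE dotDl !dotDr (dotC y x); ring. Qed.

Lemma dot_le x y : 2 * dot x y <= `|x| ^+ 2 + `|y| ^+ 2.
Proof.
by have := sqr_ge0 `|x - y|; rewrite normD_sqr normrN dotNr; lra.
Qed.

End HilbertDot.

(** * Norms of operator matrices *)

Section OperatorNorm.
Variables (R : realType) (H : hilbertSpace R).
Local Notation dot := (hilbert_dot H).

Lemma bopP (T : bop H) : linear T /\ exists M : R, forall x, `|T x| <= M * `|x|.
Proof. by apply/asboolP; exact: (valP T). Qed.

Lemma bopD (T : bop H) x y : T (x + y) = T x + T y.
Proof. by have [l _] := bopP T; have := l 1 x y; rewrite !scale1r. Qed.

Lemma bop0 (T : bop H) : T 0 = 0.
Proof. by apply: (addrI (T 0)); rewrite -bopD !addr0. Qed.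

Lemma bopZ (T : bop H) t x : T (t *: x) = t *: T x.
Proof. by have [l _] := bopP T; have := l t x 0; rewrite !addr0 bop0 addr0. Qed.

Lemma bop_bounded (T : bop H) : exists2 M : R, 0 <= M & forall x, `|T x| <= M * `|x|.
Proof.
have [_ [M TM]] := bopP T; exists `|M| => // x.
by apply: le_trans (TM x) _; rewrite ler_wpM2r// ler_norm.
Qed.

Lemma bop_ext (S T : bop H) : (forall x, S x = T x) -> S = T.
Proof. by move=> ST; apply: val_inj; apply/funext. Qed.

Lemma bop_addE (S T : bop H) : (S + T : bop H) = (fun x => S x + T x) :> (H -> H).
Proof. by rewrite -[LHS]/(val (S + T)) raddfD. Qed.

Lemma bop_scaleE t (T : bop H) : (t *: T : bop H) = (fun x => t *: T x) :> (H -> H).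
Proof. by rewrite -[LHS]/(val (t *: T)) linearZ. Qed.

Lemma bop_0E : (0 : bop H) = (fun x => 0) :> (H -> H).
Proof. by rewrite -[LHS]/(val 0) raddf0. Qed.

Lemma l2norm_sqr n (v : 'cV[H]_n) : l2norm v ^+ 2 = \sum_i `|v i ord0| ^+ 2.
Proof. by rewrite sqr_sqrtr// sumr_ge0// => i _; rewrite sqr_ge0. Qed.

Lemma l2norm_ge0 n (v : 'cV[H]_n) : 0 <= l2norm v.
Proof. exact: sqrtr_ge0. Qed.

Lemma l2normZ n t (v : 'cV[H]_n) : l2norm (\col_i (t *: v i ord0)) = `|t| * l2norm v.
Proof.
rewrite /l2norm -sqrtr_sqr -sqrtrM ?sqr_ge0// mulr_sumr; congr Num.sqrt.
by apply: eq_bigr => i _; rewrite mxE normrZ exprMn real_normK ?num_real.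
Qed.

Lemma le_l2norm n (v : 'cV[H]_n) i : `|v i ord0| <= l2norm v.
Proof.
rewrite -ler_sqr ?nnegrE ?l2norm_ge0// l2norm_sqr (bigD1 i)//= lerDl.
by rewrite sumr_ge0// => j _; rewrite sqr_ge0.
Qed.

Lemma mxopZ n (T : 'M[bop H]_n) t (v : 'cV[H]_n) :
  mxop T (\col_i (t *: v i ord0)) = \col_i (t *: mxop T v i ord0).
Proof.
apply/matrixP => i j; rewrite !mxE scaler_sumr; apply: eq_bigr => k _.
by rewrite mxE bopZ.
Qed.

Lemma mxop_bounded n (T : 'M[bop H]_n) :
  exists2 M : R, 0 <= M & forall v, l2norm (mxop T v) <= M * l2norm v.
Proof.
have [M M0 TM] : exists2 M : R, 0 <= M &
    forall (v : 'cV[H]_n) i, `|mxop T v i ord0| <= M * l2norm v.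
  have TB i j := cid2 (bop_bounded (T i j)).
  exists (\sum_i \sum_j s2val (TB i j)).
    by apply: sumr_ge0 => i _; apply: sumr_ge0 => j _; case: (TB i j).
  move=> v i; rewrite mxE (le_trans (ler_norm_sum _ _ _))// mulr_suml.
  rewrite [leRHS](bigD1 i)//= -[leLHS]addr0 lerD//.
    rewrite mulr_suml; apply: ler_sum => j _; case: (TB i j) => /= M M0 TM.
    by rewrite (le_trans (TM _))// ler_wpM2l// le_l2norm.
  apply: sumr_ge0 => k _; rewrite mulr_ge0 ?l2norm_ge0//.
  by apply: sumr_ge0 => j _; case: (TB k j).
exists (Num.sqrt (M ^+ 2 *+ n)) => [|v]; first exact: sqrtr_ge0.
rewrite -ler_sqr ?nnegrE ?mulr_ge0 ?sqrtr_ge0 ?l2norm_ge0//.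
rewrite [leLHS]l2norm_sqr exprMn sqr_sqrtr ?mulrn_wge0 ?sqr_ge0//.
rewrite (@le_trans _ _ (\sum_(i < n) (M * l2norm v) ^+ 2))//.
  by apply: ler_sum => i _; rewrite lerXn2r ?nnegrE ?mulr_ge0 ?l2norm_ge0.
by rewrite sumr_const card_ord exprMn mulrnAl.
Qed.

Lemma opnorm_has_sup n (T : 'M[bop H]_n) :
  has_sup [set l2norm (mxop T v) | v in [set v | l2norm v <= 1]].
Proof.
have [M M0 TM] := mxop_bounded T; split.
  exists (l2norm (mxop T (\col__ 0))), (\col__ 0) => //=.
  by rewrite /l2norm big1 ?sqrtr0// => i _; rewrite mxE normr0 expr0n.
exists M => _ [v /= v1 <-]; apply: le_trans (TM v) _.
by rewrite ler_piMr.
Qed.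

Lemma opnorm_ge0 n (T : 'M[bop H]_n) : 0 <= opnorm T.
Proof.
have [[x [v v1 _]] b] := opnorm_has_sup T.
by apply: le_trans (l2norm_ge0 (mxop T v)) _; apply: ub_le_sup => //; exists v.
Qed.

Lemma mxop_le n (T : 'M[bop H]_n) (v : 'cV[H]_n) : l2norm (mxop T v) <= opnorm T * l2norm v.
Proof.
have [v0|v0] := eqVneq (l2norm v) 0.
  by have [M _ /(_ v)] := mxop_bounded T; rewrite v0 !mulr0.
have vp : 0 < l2norm v by rewrite lt_def v0 l2norm_ge0.
have nv : `|(l2norm v)^-1| = (l2norm v)^-1 by rewrite ger0_norm// invr_ge0 ltW.
rewrite -ler_pdivrMr// mulrC -nv -l2normZ -mxopZ.
apply: ub_le_sup; first exact: (opnorm_has_sup T).2.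
exists (\col_i ((l2norm v)^-1 *: v i ord0)) => //=.
by rewrite l2normZ nv mulVf.
Qed.

Lemma opnorm_le n (T : 'M[bop H]_n) (r : R) : 0 <= r ->
  (forall v, l2norm (mxop T v) <= r * l2norm v) -> opnorm T <= r.
Proof.
move=> r0 Tr; apply: ge_sup; first exact: (opnorm_has_sup T).1.
by move=> _ [v /= v1 <-]; apply: le_trans (Tr v) _; rewrite ler_piMr.
Qed.

(* The two squares absorb the factor [r], which makes this form of the norm
   inequality additive over direct sums. *)
Lemma opnorm_leP n (T : 'M[bop H]_n) (r : R) : 0 <= r ->
  opnorm T <= r <->
  forall z w : 'I_n -> H, 2 * \sum_i \sum_j dot (T i j (z j)) (w i) <=
    \sum_j `|z j| ^+ 2 + r ^+ 2 * \sum_i `|w i| ^+ 2.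
Proof.
move=> r0.
have opE z (w : 'I_n -> H) : \sum_i \sum_j dot (T i j (z j)) (w i) =
    \sum_i dot (mxop T (\col_j z j) i ord0) (w i).
  by apply: eq_bigr => i _; rewrite mxE dot_suml; apply: eq_bigr => j _; rewrite mxE.
split=> [Tr z w|Tr].
  rewrite opE; set v := mxop T _.
  have vz : \sum_i `|v i ord0| ^+ 2 <= r ^+ 2 * \sum_j `|z j| ^+ 2.
    have -> : \sum_j `|z j| ^+ 2 = l2norm (\col_j z j) ^+ 2.
      by rewrite l2norm_sqr; apply: eq_bigr => j _; rewrite mxE.
    rewrite -l2norm_sqr -exprMn lerXn2r ?nnegrE ?mulr_ge0 ?l2norm_ge0//.
    by rewrite (le_trans (mxop_le _ _))// ler_wpM2r// l2norm_ge0.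
  have [r00|rn0] := eqVneq r 0.
    have v0 i : v i ord0 = 0.
      apply/eqP; rewrite -normr_eq0 -sqrf_eq0; apply/eqP/le_anti.
      rewrite sqr_ge0 andbT; apply: le_trans (_ : \sum_i `|v i ord0| ^+ 2 <= 0).
        by rewrite (bigD1 i)//= lerDl sumr_ge0// => j _; rewrite sqr_ge0.
      by rewrite (le_trans vz)// r00 expr0n mul0r.
    rewrite big1 ?mulr0 => [|i _]; last by rewrite v0 dot0l.
    rewrite addr_ge0 ?mulr_ge0 ?sqr_ge0// sumr_ge0// => i _; exact: sqr_ge0.
  have r2 : 0 < r ^+ 2 by rewrite exprn_even_gt0.
  rewrite -(ler_pM2l r2) mulrDr; apply: le_trans (lerD vz (lexx _)).
  rewrite !mulr_sumr -big_split /=; apply: ler_sum => i _.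
  have := dot_le (v i ord0) (r ^+ 2 *: w i).
  by rewrite dotZr normrZ ger0_norm ?sqr_ge0// exprMn; lra.
apply: opnorm_le => // v.
rewrite -ler_sqr ?nnegrE ?mulr_ge0 ?l2norm_ge0//.
rewrite exprMn [leLHS]l2norm_sqr l2norm_sqr.
set a := \sum_i _; set b := \sum_i _.
have a0 : 0 <= a by rewrite sumr_ge0// => i _; rewrite sqr_ge0.
have b0 : 0 <= b by rewrite sumr_ge0// => i _; rewrite sqr_ge0.
(* Test with [w = t * T v]: below, [t = 1 / r ^+ 2] gives the bound, and for [r = 0] a large [t]
   forces [a <= 0]. *)
have Tt t : 2 * t * a <= b + r ^+ 2 * (t ^+ 2 * a).
  have := Tr (fun j => v j ord0) (fun i => t *: mxop T v i ord0).
  rewrite opE; have -> : \col_j v j ord0 = v.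
    by apply/matrixP => i j; rewrite mxE (ord1 j).
  rewrite -/b; congr (_ <= _ + _ * _).
    rewrite mulr_sumr /a mulr_sumr; apply: eq_bigr => i _.
    by rewrite dotZr hilbert_normE mulrA.
  rewrite mulr_sumr; apply: eq_bigr => i _.
  by rewrite normrZ exprMn real_normK ?num_real.
have [r00|rn0] := eqVneq r 0.
  rewrite r00 expr0n mul0r leNgt; apply/negP => ap.
  have := Tt ((b + 1) / a); rewrite r00 expr0n mul0r addr0 -mulrA divfK ?gt_eqF//.
  by lra.
have r2 : 0 < r ^+ 2 by rewrite exprn_even_gt0.
have : r ^+ 2 * (2 / r ^+ 2 * a) <= r ^+ 2 * (b + r ^+ 2 * ((r ^+ 2)^-1 ^+ 2 * a)).
  by rewrite ler_pM2l.
have -> : r ^+ 2 * (2 / r ^+ 2 * a) = 2 * a by field.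
have -> : r ^+ 2 * (b + r ^+ 2 * ((r ^+ 2)^-1 ^+ 2 * a)) = r ^+ 2 * b + a by field.
by lra.
Qed.

End OperatorNorm.

Lemma sum_bij (V : nmodType) (I J : finType) (g : J -> I) (F : I -> V) :
  bijective g -> \sum_i F i = \sum_j F (g j).
Proof. by move=> bg; apply: reindex; exact: onW_bij. Qed.
Arguments sum_bij {V I J g} F _.

(** * Matrices over the algebra with arbitrary finite index types *)

Section OperatorMatrices.
Variables (R : realType) (A : completeNormedModType R) (nA : mxnorms R A).
Variables (K : hilbertSpace R) (f : {linear A -> bop K}).
Hypothesis f_isometric : completely_isometric nA (@opnorm R K) f.

Definition opform (a : A) (z w : K) : R := hilbert_dot K (f a z) w.

Lemma opformD a b z w : opform (a + b) z w = opform a z w + opform b z w.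
Proof. by rewrite /opform linearD bop_addE dotDl. Qed.

Lemma opformZ t a z w : opform (t *: a) z w = t * opform a z w.
Proof. by rewrite /opform linearZ bop_scaleE dotZl. Qed.

Lemma opform0 z w : opform 0 z w = 0.
Proof. by rewrite /opform linear0 bop_0E dot0l. Qed.

Lemma opformB a b z w : opform (a - b) z w = opform a z w - opform b z w.
Proof. by rewrite -scaleN1r opformD opformZ mulN1r. Qed.

Lemma opformDm a z z' w : opform a (z + z') w = opform a z w + opform a z' w.
Proof. by rewrite /opform bopD dotDl. Qed.

Lemma opformZm t a z w : opform a (t *: z) w = t * opform a z w.
Proof. by rewrite /opform bopZ dotZl. Qed.

Lemma opform0m a w : opform a 0 w = 0.
Proof. by rewrite /opform bop0 dot0l. Qed.

Lemma opformZr t a z w : opform a z (t *: w) = t * opform a z w.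
Proof. by rewrite /opform dotZr. Qed.

Lemma opform0r a z : opform a z 0 = 0.
Proof. exact: dot0r. Qed.

(* The operator matrix [x] has norm at most [sqrt C]. *)
Definition mxle (I J : finType) (x : I -> J -> A) (C : R) :=
  forall (z : J -> K) (w : I -> K),
    2 * \sum_i \sum_j opform (x i j) (z j) (w i) <=
    \sum_j `|z j| ^+ 2 + C * \sum_i `|w i| ^+ 2.

Lemma eq_mxle (I J : finType) (x y : I -> J -> A) C :
  x =2 y -> mxle x C -> mxle y C.
Proof.
move=> xy + z w => /(_ z w); congr (_ * _ <= _).
by apply: eq_bigr => i _; apply: eq_bigr => j _; rewrite xy.
Qed.

Lemma nA_leP n (x : 'M[A]_n) r : 0 <= r -> nA x <= r <-> mxle x (r ^+ 2).
Proof.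
move=> r0; rewrite -f_isometric opnorm_leP//; split=> h z w; have := h z w;
  by congr (_ * _ <= _); apply: eq_bigr => i _; apply: eq_bigr => j _; rewrite mxE.
Qed.

Lemma nA_ge0 n (x : 'M[A]_n) : 0 <= nA x.
Proof. by rewrite -f_isometric opnorm_ge0. Qed.

Lemma mxle_nA n (x : 'M[A]_n) : mxle x (nA x ^+ 2).
Proof. by apply/nA_leP => //; exact: nA_ge0. Qed.

Lemma mxle_reindex (I J I' J' : finType) (g : I' -> I) (h : J' -> J)
    (x : I -> J -> A) C : bijective g -> bijective h ->
  mxle x C <-> mxle (fun i j => x (g i) (h j)) C.
Proof.
move=> bg bh; have [g' gK g'K] := bg; have [h' hK h'K] := bh; split=> xC z w.
  have := xC (z \o h') (w \o g') => /=.
  rewrite (sum_bij _ bg) (sum_bij (fun j => `|z (h' j)| ^+ 2) bh).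
  rewrite (sum_bij (fun i => `|w (g' i)| ^+ 2) bg).
  congr (_ * _ <= _ + _ * _).
  - by apply: eq_bigr => i _; rewrite (sum_bij _ bh); apply: eq_bigr => j _; rewrite gK hK.
  - by apply: eq_bigr => j _; rewrite hK.
  - by apply: eq_bigr => i _; rewrite gK.
have := xC (z \o h) (w \o g) => /=.
rewrite -(sum_bij (fun j => `|z j| ^+ 2) bh) -(sum_bij (fun i => `|w i| ^+ 2) bg).
rewrite (sum_bij (fun i => \sum_j opform (x i j) (z j) (w i)) bg).
by congr (_ * _ <= _); apply: eq_bigr => i _; rewrite [RHS](sum_bij _ bh).
Qed.

Lemma block_opform m n (x : 'M[A]_(m, n)) (z w : 'I_(m + n) -> K) :
  \sum_i \sum_j opform (block_mx 0 x 0 0 i j) (z j) (w i) =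
  \sum_i \sum_j opform (x i j) (z (rshift m j)) (w (lshift n i)).
Proof.
rewrite big_split_ord /= [X in _ + X]big1 ?addr0 => [|i _]; last first.
  rewrite big_split_ord /= !big1 ?addr0// => j _.
    by rewrite block_mxEdr mxE opform0.
  by rewrite block_mxEdl mxE opform0.
apply: eq_bigr => i _; rewrite big_split_ord /= big1 ?add0r => [|j _].
  by apply: eq_bigr => j _; rewrite block_mxEur.
by rewrite block_mxEul mxE opform0.
Qed.

(** One direction extends [z] and [w] by zero vectors; the other discards the squares of the vectors
    that the corner does not meet. *)
Lemma rectnorm_leP m n (x : 'M[A]_(m, n)) r : 0 <= r ->
  rectnorm nA x <= r <-> mxle x (r ^+ 2).
Proof.
move=> r0; rewrite nA_leP//; split=> h z w.
  pose z' (k : 'I_(m + n)) := if fintype.split k is inr j then z j else 0.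
  pose w' (k : 'I_(m + n)) := if fintype.split k is inl i then w i else 0.
  have zl i : z' (lshift n i) = 0 by rewrite /z' (unsplitK (inl i)).
  have zr j : z' (rshift m j) = z j by rewrite /z' (unsplitK (inr j)).
  have wl i : w' (lshift n i) = w i by rewrite /w' (unsplitK (inl i)).
  have wr j : w' (rshift m j) = 0 by rewrite /w' (unsplitK (inr j)).
  have := h z' w'; rewrite block_opform.
  rewrite (big_split_ord _ _ (fun k => `|z' k| ^+ 2)) (big_split_ord _ _ (fun k => `|w' k| ^+ 2)) /=.
  rewrite [X in _ <= X + _ + _]big1 ?add0r => [|i _]; last by rewrite zl normr0 expr0n.
  rewrite [X in _ <= _ + _ * (_ + X)]big1 ?addr0 => [|i _]; last by rewrite wr normr0 expr0n.
  congr (_ * _ <= _ + _ * _).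
  - by apply: eq_bigr => i _; apply: eq_bigr => j _; rewrite zr wl.
  - by apply: eq_bigr => j _; rewrite zr.
  - by apply: eq_bigr => j _; rewrite wl.
rewrite block_opform; apply: le_trans (h _ _) _.
rewrite (big_split_ord _ _ (fun k => `|z k| ^+ 2)) (big_split_ord _ _ (fun k => `|w k| ^+ 2)) /=.
apply: lerD; first by rewrite lerDr sumr_ge0// => i _; rewrite sqr_ge0.
by rewrite ler_wpM2l ?sqr_ge0// lerDl sumr_ge0// => i _; rewrite sqr_ge0.
Qed.

Lemma rectnorm_ge0 m n (x : 'M[A]_(m, n)) : 0 <= rectnorm nA x.
Proof. exact: nA_ge0. Qed.

Lemma mxle_rectnorm m n (x : 'M[A]_(m, n)) : mxle x (rectnorm nA x ^+ 2).
Proof. by apply/rectnorm_leP => //; exact: nA_ge0. Qed.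

Lemma rectnorm_square n (x : 'M[A]_n) : rectnorm nA x = nA x.
Proof.
apply/le_anti/andP; split.
  by apply/rectnorm_leP; [exact: nA_ge0|exact: mxle_nA].
by apply/nA_leP; [exact: nA_ge0|exact: mxle_rectnorm].
Qed.

Definition dsum (I J I' J' : finType) (x : I -> J -> A) (y : I' -> J' -> A)
    (k : I + I') (l : J + J') : A :=
  match k, l with inl i, inl j => x i j | inr i, inr j => y i j | _, _ => 0 end.

Lemma mxle_dsum (I J I' J' : finType) (x : I -> J -> A) (y : I' -> J' -> A) C :
  mxle x C -> mxle y C -> mxle (dsum x y) C.
Proof.
move=> xC yC z w; rewrite !big_sumType /=.
have -> : \sum_i \sum_j opform (dsum x y (inl i) j) (z j) (w (inl i)) =
    \sum_i \sum_j opform (x i j) (z (inl j)) (w (inl i)).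
  apply: eq_bigr => i _; rewrite big_sumType /= [X in _ + X]big1 ?addr0// => j _.
  exact: opform0.
have -> : \sum_i \sum_j opform (dsum x y (inr i) j) (z j) (w (inr i)) =
    \sum_i \sum_j opform (y i j) (z (inr j)) (w (inr i)).
  apply: eq_bigr => i _; rewrite big_sumType /= big1 ?add0r// => j _.
  exact: opform0.
have := xC (z \o inl) (w \o inl); have := yC (z \o inr) (w \o inr).
by rewrite /=; lra.
Qed.

Lemma mxle_diag (I : finType) (e : A) : norm1 nA e <= 1 ->
  mxle (fun i j : I => if i == j then e else 0) 1.
Proof.
move=> e1 z w; have e1' : mxle (fun _ _ : 'I_1 => e) 1.
  have /(nA_leP _ ler01) : @nA 1%N (const_mx e) <= 1 by [].
  by rewrite expr1n; apply: eq_mxle => i j; rewrite mxE.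
rewrite mul1r mulr_sumr -big_split /=; apply: ler_sum => i _.
rewrite (bigD1 i)//= big1 ?addr0 => [|j /negbTE ji]; last first.
  by rewrite eq_sym ji opform0.
by rewrite eqxx; have := e1' (fun=> z i) (fun=> w i); rewrite !big_ord1 mul1r.
Qed.

Variable mul : {bilinear A -> A -> A}.

Definition fmul (I J L : finType) (x : I -> J -> A) (y : J -> L -> A) i l :=
  \sum_j mul (x i j) (y j l).

Hypothesis matrix_algebras : matrix_banach_algebras mul nA.

Lemma mxle_fmul_square (T : finType) (x y : T -> T -> A) C D :
  0 <= C -> 0 <= D -> mxle x C -> mxle y D -> mxle (fmul x y) (C * D).
Proof.
move=> C0 D0 xC yD; have bT : bijective (@enum_val T predT) := enum_val_bij T.
pose mx (u : T -> T -> A) : 'M[A]_#|T| := (\matrix_(i, j) u (enum_val i) (enum_val j))%R.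
have mxP (u : T -> T -> A) E : 0 <= E -> nA (mx u) <= Num.sqrt E <-> mxle u E.
  move=> E0; rewrite nA_leP ?sqrtr_ge0// sqr_sqrtr//.
  rewrite (mxle_reindex _ _ bT bT); split; apply: eq_mxle => i j;
  by rewrite mxE.
apply/mxP; first exact: mulr_ge0.
have -> : mx (fmul x y) = mxalg_mul mul (mx x) (mx y).
  apply/matrixP => i j; rewrite !mxE /fmul (sum_bij _ bT).
  by apply: eq_bigr => k _; rewrite !mxE.
rewrite (le_trans (matrix_algebras _ _))// sqrtrM// ler_pM ?nA_ge0//; exact/mxP.
Qed.

(** The hypothesis concerns square matrices only, so [x] and [y] become the blocks [(I, J)] and
    [(J, L)] of square matrices over [I + J + L], whose product has [fmul x y] as its block
    [(I, L)]. *)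
Lemma mxle_fmul (I J L : finType) (x : I -> J -> A) (y : J -> L -> A) C D :
  0 <= C -> 0 <= D -> mxle x C -> mxle y D -> mxle (fmul x y) (C * D).
Proof.
move=> C0 D0 xC yD.
pose x' (s t : I + J + L) :=
  match s, t with inl (inl i), inl (inr j) => x i j | _, _ => 0 end.
pose y' (s t : I + J + L) :=
  match s, t with inl (inr j), inr l => y j l | _, _ => 0 end.
have sum0 (T : finType) (z : T -> K) w : \sum_t opform 0 (z t) w = 0.
  by rewrite big1// => t _; rewrite opform0.
have sum00 (S T : finType) (z : T -> K) (w : S -> K) :
    \sum_s \sum_t opform 0 (z t) (w s) = 0.
  by rewrite big1// => s _; rewrite sum0.
have sqr0 (T : finType) (z : T -> K) : 0 <= \sum_t `|z t| ^+ 2.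
  by rewrite sumr_ge0// => t _; rewrite sqr_ge0.
have x'C : mxle x' C.
  move=> z w; have := xC (z \o inl \o inr) (w \o inl \o inl).
  have -> : \sum_s \sum_t opform (x' s t) (z t) (w s) =
      \sum_i \sum_j opform (x i j) (z (inl (inr j))) (w (inl (inl i))).
    rewrite big_sumType big_sumType /= !sum00 !addr0; apply: eq_bigr => i _.
    by rewrite big_sumType big_sumType /= !sum0 add0r addr0.
  move/le_trans; apply; rewrite !big_sumType /=.
  apply: lerD; last by rewrite ler_wpM2l// -addrA lerDl addr_ge0.
  by rewrite addrAC lerDr addr_ge0.
have y'D : mxle y' D.
  move=> z w; have := yD (z \o inr) (w \o inl \o inr).
  have -> : \sum_s \sum_t opform (y' s t) (z t) (w s) =
      \sum_j \sum_l opform (y j l) (z (inr l)) (w (inl (inr j))).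
    rewrite big_sumType big_sumType /= !sum00 add0r addr0; apply: eq_bigr => j _.
    by rewrite big_sumType big_sumType /= !sum0 !add0r.
  move/le_trans; apply; rewrite !big_sumType /=.
  apply: lerD; first by rewrite lerDr addr_ge0.
  by rewrite ler_wpM2l// addrAC lerDr addr_ge0.
move=> z w.
pose z' (t : I + J + L) := if t is inr l then z l else 0.
pose w' (s : I + J + L) := if s is inl (inl i) then w i else 0.
have s0 (T : finType) : \sum_(t : T) `|0 : K| ^+ 2 = 0.
  by rewrite big1// => t _; rewrite normr0 expr0n.
have := mxle_fmul_square C0 D0 x'C y'D z' w'.
congr (2 * _ <= _ + _ * _); last 2 first.
- by rewrite !big_sumType /= !s0 !add0r.
- by rewrite !big_sumType /= !s0 !addr0.
rewrite big_sumType big_sumType /=.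
rewrite [X in _ + X]big1 ?addr0 => [|l _]; last first.
  by rewrite big1// => t _; rewrite opform0r.
rewrite [X in _ + X]big1 ?addr0 => [|j _]; last first.
  by rewrite big1// => t _; rewrite opform0r.
apply: eq_bigr => i _; rewrite big_sumType /= big1 ?add0r => [|s _]; last first.
  by rewrite opform0m.
apply: eq_bigr => l _; congr opform; rewrite /fmul big_sumType big_sumType /=.
rewrite big1 => [|i' _]; last by rewrite linear0l.
rewrite add0r [X in _ + X]big1 ?addr0// => l' _; exact: linear0l.
Qed.


End OperatorMatrices.
Section NormForm.
Variables (R : realType) (H : hilbertSpace R).

Lemma normq_scale (t : R) (z : H) : `|t *: z| ^+ 2 = t ^+ 2 * `|z| ^+ 2.
Proof. by rewrite normrZ exprMn real_normK ?num_real. Qed.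

Lemma normq_parallelogram (x y : H) :
  `|x + y| ^+ 2 + `|x - y| ^+ 2 = 2 * `|x| ^+ 2 + 2 * `|y| ^+ 2.
Proof. by rewrite !normD_sqr normrN dotNr; ring. Qed.

Definition normq : qform H :=
  QForm (fun z => sqr_ge0 `|z|) normq_scale normq_parallelogram.

End NormForm.

(** The suprema run over independent vectors, so vectors nearly attaining each of them form one
    joint choice to which the bound applies. *)
Lemma sum_conjq_le (R : realType) (V : lmodType R) (s : qform V) (I : finType)
    (phi : I -> V -> R) (C : R) :
  (forall i, exists D, conj_bounded s (phi i) D) ->
  (forall v : I -> V, \sum_i (2 * phi i (v i) - s (v i)) <= C) ->
  \sum_i conjq s (phi i) <= C.
Proof.
move=> b h; apply/ler_addgt0Pr => e e0.
(* The successor keeps the denominator positive when [I] is empty. *)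
have n0 : (0 : R) < #|I|.+1%:R by rewrite ltr0n.
have d0 : 0 < e / #|I|.+1%:R by rewrite divr_gt0.
have [d dE] : exists d, d = e / #|I|.+1%:R by exists (e / #|I|.+1%:R).
rewrite -dE in d0.
have near i : exists v, conjq s (phi i) - d < 2 * phi i v - s v.
  have [D bD] := b i.
  have hs : has_sup (range (fun v => 2 * phi i v - s v)).
    by split; [exists (2 * phi i 0 - s 0), 0|exists D => _ [v _ <-]].
  by have [_ [v _ <-] lt] := sup_adherent d0 hs; exists v.
have [v vP] := choice near.
apply: le_trans (lerD (h v) (lexx e)).
apply: (@le_trans _ _ (\sum_i (2 * phi i (v i) - s (v i) + d))).
  by apply: ler_sum => i _; have := vP i; lra.
rewrite big_split lerD2l sumr_const -mulr_natl dE mulrCA ger_pMr//.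
by rewrite ler_pdivrMr// mul1r ler_nat.
Qed.

(** * Monotone minorants are quadratic forms *)

Section QuadraticMinorant.
Variables (R : realType) (E : lmodType R) (Theta : Type) (h : Theta -> qform E).
Variables (N : Theta -> R) (s : E -> R).
Hypothesis s_ge0 : forall x, 0 <= s x.
Hypothesis s_dominates : forall X Z,
  dominates h N X Z -> \sum_(z <- Z) s z <= \sum_(x <- X) s x.

(** Lists of equal cost at every parameter dominate each other, so [s] satisfies every identity
    between sums of costs; [s_split] and the parallelogram law are instances. *)
Let s_cost X Z : cost h X =1 cost h Z -> \sum_(z <- Z) s z = \sum_(x <- X) s x.
Proof.
move=> XZ; apply/le_anti/andP; split; apply: s_dominates;
by apply: dominates_cost (@dominates_refl _ _ _ _ _ _) => // th; rewrite XZ.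
Qed.

Let s_split a b c x : c ^+ 2 = a ^+ 2 + b ^+ 2 ->
  s (c *: x) = s (a *: x) + s (b *: x).
Proof.
move=> abc; have := @s_cost [:: a *: x; b *: x] [:: c *: x].
rewrite !big_cons !big_nil !addr0; apply => th.
by rewrite /cost !big_cons !big_nil !addr0 !qfZ abc mulrDl.
Qed.

(** By [s_split] the function [u |-> s (sqrt u *: x)] is additive, and on [[0, 1]] it is at most
    [s x], the remainder being [s (sqrt (1 - u) *: x) >= 0]. *)
Let sZ t x : s (t *: x) = t ^+ 2 * s x.
Proof.
have s0 : s 0 = 0.
  have := @s_split 0 0 0 0; rewrite expr0n scaler0 addr0 => /(_ erefl); lra.
have pos a : 0 <= a -> s (a *: x) = a ^+ 2 * s x.
  move=> a0; have H := @additive_bounded_linear R (fun u => s (Num.sqrt u *: x)) (s x).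
  have := H _ _ (a ^+ 2) (sqr_ge0 a).
  rewrite sqrtr_sqr ger0_norm// sqrtr1 scale1r; apply=> [b c b0 c0|b /andP[b0 b1]].
    by apply: s_split; rewrite !sqr_sqrtr// addr_ge0.
  rewrite ger0_norm// -[in leRHS](scale1r x).
  have -> := @s_split (Num.sqrt b) (Num.sqrt (1 - b)) 1 x; first by rewrite lerDl.
  by rewrite !sqr_sqrtr ?subr_ge0// expr1n addrC subrK.
have [t0|t0] := leP 0 t; first exact: pos.
have := @s_split (- t) 0 t x; rewrite sqrrN expr0n addr0 scale0r s0 addr0 => ->//.
by rewrite pos ?sqrrN//; lra.
Qed.

Let s_parallelogram x y : s (x + y) + s (x - y) = 2 * s x + 2 * s y.
Proof.
have := @s_cost [:: x + y; x - y] [:: Num.sqrt 2 *: x; Num.sqrt 2 *: y].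
rewrite !big_cons !big_nil !addr0 !sZ !sqr_sqrtr// => -> // th.
by rewrite /cost !big_cons !big_nil !addr0 qf_parallelogram !qfZ !sqr_sqrtr.
Qed.

Definition minorant_qform : qform E := QForm s_ge0 sZ s_parallelogram.

End QuadraticMinorant.

(** * Columns over the algebra and their costs *)

Section ColumnForms.
Variables (R : realType) (A : completeNormedModType R) (nA : mxnorms R A).
Variables (K : hilbertSpace R) (f : {linear A -> bop K}).
Hypothesis f_isometric : completely_isometric nA (@opnorm R K) f.
Hypothesis nA_norm : forall a, norm1 nA a = `|a|.
Local Notation opform := (opform f).
Local Notation mxle := (mxle f).
Local Notation E := (nat -> A).

Definition weight n (w : 'I_n -> K) : R := \sum_i `|w i| ^+ 2.

(** The pairing of [x z] with [w]. Columns are infinite sequences of which only the first [n]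
    entries are read, so that one module [E] serves all sizes. *)
Definition colform n (w : 'I_n -> K) (x : E) (z : K) : R :=
  \sum_(k < n) opform (x k) z (w k).

Lemma colform_scalar n w x : scalar (@colform n w x).
Proof.
move=> t u v; rewrite /colform mulr_sumr -big_split; apply: eq_bigr => k _.
by rewrite opformDm opformZm.
Qed.

Lemma weight_ge0 n w : 0 <= @weight n w.
Proof. by rewrite sumr_ge0// => i _; rewrite sqr_ge0. Qed.

Lemma mxle_exists m n (x : 'I_m -> 'I_n -> A) : exists2 C, 0 <= C & mxle x C.
Proof.
exists (rectnorm nA (\matrix_(i, j) x i j) ^+ 2); first exact: sqr_ge0.
apply: eq_mxle (mxle_rectnorm f_isometric _) => i j.
by rewrite mxE.
Qed.

Lemma colform_bounded n (x : E) : exists C, forall w : 'I_n -> K,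
  conj_bounded (normq K) (colform w x) (C * weight w).
Proof.
have [C _ xC] := mxle_exists (fun (k : 'I_n) (_ : 'I_1) => x k).
exists C => w z; have := xC (fun=> z) w; rewrite big_ord1 /=.
under eq_bigr do rewrite big_ord1.
by rewrite -lerBlDl.
Qed.

Let cq n (w : 'I_n -> K) (x : E) := conjq (normq K) (colform w x).

Lemma colq_ge0 n w x : 0 <= @cq n w x.
Proof. have [C b] := colform_bounded n x; exact: conjq_ge0 (colform_scalar _ _) (b w). Qed.

Lemma colqZ n w t x : @cq n w (t *: x) = t ^+ 2 * cq w x.
Proof.
have [C b] := colform_bounded n x; rewrite -(conjqZ t (colform_scalar _ _) (b w)).
congr conjq; apply/funext => z; rewrite mulr_sumr; apply: eq_bigr => k _.
exact: opformZ.
Qed.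

Lemma colq_parallelogram n w x y :
  @cq n w (x + y) + cq w (x - y) = 2 * cq w x + 2 * cq w y.
Proof.
have [C b] := colform_bounded n x; have [D b'] := colform_bounded n y.
rewrite /cq -(conjq_parallelogram (colform_scalar _ _) (colform_scalar _ _) (b w) (b' w)).
congr (_ + _); congr conjq; apply/funext => z.
  by rewrite -big_split; apply: eq_bigr => k _; exact: opformD.
by rewrite -sumrB; apply: eq_bigr => k _; exact: opformB.
Qed.

(* [colq w x] is [|x^* w|^2], where the column [x] is an operator [K -> K^n]. *)
Definition colq n (w : 'I_n -> K) : qform E :=
  QForm (colq_ge0 w) (colqZ w) (colq_parallelogram w).

Lemma colq_ub n (w : 'I_n -> K) x z : 2 * colform w x z - `|z| ^+ 2 <= colq w x.
Proof. by have [C b] := colform_bounded n x; exact: conjq_ub (b w). Qed.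

(** With [X] the matrix of columns [x j], the sum is [|X^* w|^2], so both sides say that [X^*] has
    norm at most [sqrt C]. A matrix norm bound thus becomes [cost_le] with weight [|w|^2]. *)
Lemma colq_mxleP n (J : finType) (x : J -> E) C :
  (forall w : 'I_n -> K, \sum_j colq w (x j) <= C * weight w) <->
  mxle (fun (k : 'I_n) j => x j k) C.
Proof.
have swap (z : J -> K) (w : 'I_n -> K) : 2 * \sum_(i < n) \sum_j opform (x j i) (z j) (w i) =
    \sum_j 2 * colform w (x j) (z j).
  by rewrite exchange_big mulr_sumr.
split=> [xC z w|xC w].
  rewrite swap -lerBlDl -sumrB; apply: le_trans (xC w).
  by apply: ler_sum => j _; exact: colq_ub.
apply: sum_conjq_le => [j|z].
  by have [D b] := colform_bounded n (x j); exists (D * weight w).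
by rewrite sumrB -swap lerBlDl; exact: xC.
Qed.

Lemma opform_le a z w d : 0 < d -> `|a| <= d ->
  2 * opform a z w <= d * (`|z| ^+ 2 + `|w| ^+ 2).
Proof.
move=> d0 ad; have d1 : norm1 nA (d^-1 *: a) <= 1.
  rewrite nA_norm normrZ (@ger0_norm _ d^-1) ?invr_ge0 ?(ltW d0)//.
  by rewrite ler_pdivrMl// mulr1.
have := mxle_diag f_isometric d1 (I := 'I_1) (fun=> z) (fun=> w).
rewrite !big_ord1 eqxx opformZ mul1r => h.
by rewrite -ler_pdivrMl//; lra.
Qed.

(** For fixed [z] and [w] the inequality depends continuously on the entries, so an entrywise limit
    inherits it with the same [C]. This lets an approximate unit replace a unit. *)
Lemma mxle_approx m (J : finType) (x : 'I_m -> J -> A) C :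
  (forall e, 0 < e -> exists2 y, mxle y C & forall i j, `|x i j - y i j| <= e) ->
  mxle x C.
Proof.
move=> h z w; apply/ler_addgt0Pr => e e0.
pose M := \sum_i \sum_j (`|z j| ^+ 2 + `|w i| ^+ 2).
have M0 : 0 <= M.
  by rewrite sumr_ge0// => i _; rewrite sumr_ge0// => j _; rewrite addr_ge0 ?sqr_ge0.
have d0 : 0 < e / (M + 1) by rewrite divr_gt0//; lra.
have [y yC xy] := h _ d0.
have := yC z w.
have -> : 2 * \sum_i \sum_j opform (x i j) (z j) (w i) =
    2 * \sum_i \sum_j opform (y i j) (z j) (w i) +
    \sum_i \sum_j 2 * opform (x i j - y i j) (z j) (w i).
  rewrite mulr_sumr [X in _ = X + _]mulr_sumr -big_split; apply: eq_bigr => i _ /=.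
  rewrite mulr_sumr [X in _ = X + _]mulr_sumr -big_split; apply: eq_bigr => j _ /=.
  by rewrite opformB; ring.
move=> h1; apply: lerD => //.
apply: (@le_trans _ _ (e / (M + 1) * M)).
  rewrite mulr_sumr; apply: ler_sum => i _; rewrite mulr_sumr; apply: ler_sum => j _.
  exact: opform_le.
by rewrite mulrAC ler_pdivrMr; [rewrite ler_wpM2l//; lra|lra].
Qed.

End ColumnForms.

(** * Forms invariant under right multiplication by contractions *)

Section ModuleAction.
Variables (R : realType) (A : completeNormedModType R) (nA : mxnorms R A).
Variables (K : hilbertSpace R) (f : {linear A -> bop K}).
Hypothesis f_isometric : completely_isometric nA (@opnorm R K) f.
Hypothesis nA_norm : forall a, norm1 nA a = `|a|.
Variable mul : {bilinear A -> A -> A}.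
Hypothesis mulA : associative mul.
Hypothesis mul_unital : approximately_unital mul.
Hypothesis matrix_algebras : matrix_banach_algebras mul nA.
Local Notation mxle := (mxle f).
Local Notation E := (nat -> A).
Local Notation colq := (colq f_isometric).

Lemma approx_unit (T : finType) (y : T -> A) eps : 0 < eps ->
  exists2 e, `|e| <= 1 &
    forall t, `|y t - mul e (y t)| <= eps /\ `|y t - mul (y t) e| <= eps.
Proof.
move=> eps0; have [I [le [u [[i0] [lexx le_trans'] dir u1 lim]]]] := mul_unital.
have [i iP] : exists i, forall j, le i j -> forall t, t \in enum T ->
    `|mul (u j) (y t) - y t| < eps /\ `|mul (y t) (u j) - y t| < eps.
  elim: (enum T) => [|t s [i iP]]; first by exists i0.
  have [j jP] := lim (y t) _ eps0; have [k [ik jk]] := dir i j.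
  exists k => l kl t'; rewrite inE => /predU1P[->|]; first exact/jP/(le_trans' _ _ _ jk).
  exact/iP/(le_trans' _ _ _ ik).
exists (u i) => // t; have [h1 h2] := iP i (lexx i) t (mem_enum _ _).
by rewrite !(distrC (y t)) !ltW.
Qed.

Definition eact (x : E) (a : A) : E := fun k => mul (x k) a.

(** Multiply [[X Y]] by the block diagonal matrix of [a] and a diagonal of [e]: the result
    [[X a, Y e]] satisfies the same bound, and [Y e] is as close to [Y] as wanted. The diagonal of
    [e] stands for the identity, which [A] may lack. *)
Lemma cost_le_act n (J L S : finType) (x : J -> E) (y : S -> E) (a : J -> L -> A) C :
  mxle a 1 -> 0 <= C ->
  (forall w : 'I_n -> K, \sum_j colq w (x j) + \sum_s colq w (y s) <= C * weight w) ->
  (forall w : 'I_n -> K, \sum_l colq w (\sum_j eact (x j) (a j l)) +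
     \sum_s colq w (y s) <= C * weight w).
Proof.
move=> a1 C0 xyC.
pose xy (t : J + S) := match t with inl j => x j | inr s => y s end.
pose zy (t : L + S) :=
  match t with inl l => \sum_j eact (x j) (a j l) | inr s => y s end.
have xyC' : mxle (fun (k : 'I_n) t => xy t k) C.
  by apply/(colq_mxleP f_isometric) => w; rewrite big_sumType; exact: xyC.
suff : mxle (fun (k : 'I_n) t => zy t k) C.
  by move=> /(colq_mxleP f_isometric) h w; have := h w; rewrite big_sumType.
apply: (mxle_approx f_isometric nA_norm) => eps eps0.
have [e e1 eP] := approx_unit (fun ks : 'I_n * S => y ks.2 ks.1) eps0.
pose b := dsum a (fun s t : S => if s == t then e else 0).
have b1 : mxle b 1.
  by apply: mxle_dsum => //; apply: (mxle_diag f_isometric); rewrite nA_norm.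
exists (fmul mul (fun (k : 'I_n) t => xy t k) b).
  by rewrite -[C]mulr1; exact: (mxle_fmul f_isometric matrix_algebras).
move=> k [l|s]; rewrite /fmul big_sumType /=.
  have -> : \sum_(s : S) mul (y s k) 0 = 0.
    by rewrite big1// => s _; exact: linear0r.
  rewrite addr0.
  suff -> : (\sum_j eact (x j) (a j l)) k = \sum_j mul (x j k) (a j l).
    by rewrite subrr normr0 ltW.
  by apply: (big_morph (fun x : E => x k)).
rewrite big1 ?add0r => [|j _]; last exact: linear0r.
rewrite (bigD1 s)//= eqxx big1 ?addr0 => [|t /negbTE ts].
  exact: (eP (k, s)).2.
by rewrite ts; exact: linear0r.
Qed.

Lemma dominates_act n (J L : finType) (x : J -> E) (a : J -> L -> A) :
  mxle a 1 -> dominates (@colq n) (@weight _ _ n)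
    [seq x j | j <- enum J] [seq \sum_j eact (x j) (a j l) | l <- enum L].
Proof.
move=> a1 Y C xC.
have costE (T : finType) (z : T -> E) w : cost (@colq n) ([seq z t | t <- enum T] ++ Y) w =
    \sum_t colq w (z t) + \sum_(i < size Y) colq w (tnth (in_tuple Y) i).
  by rewrite cost_cat /cost big_map big_enum (big_tnth _ _ Y).
have pos (T : finType) (z : T -> E) w : 0 <= \sum_t @colq n w (z t).
  by rewrite sumr_ge0// => t _; exact: qf_ge0.
have xC' (w : 'I_n -> K) : \sum_j colq w (x j) + \sum_(i < size Y) colq w (tnth (in_tuple Y) i) <=
    C * weight w.
  by have := xC w; rewrite costE.
have [C0|C0] := leP 0 C.
  by move=> w; rewrite costE; exact: cost_le_act.
(* For [C < 0] the hypothesis forces every weight to vanish, and the case [C = 0] applies. *)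
have W0 (w : 'I_n -> K) : weight w = 0.
  apply/le_anti; rewrite weight_ge0 andbT -(nmulr_rge0 _ C0).
  by apply: le_trans (xC' w); rewrite addr_ge0.
move=> w; rewrite costE W0 mulr0.
have := @cost_le_act n _ _ _ x (tnth (in_tuple Y)) a 0 a1 (lexx _) _ w.
by rewrite mul0r; apply => w'; have := xC' w'; rewrite W0 !mulr0.
Qed.

(** [invariant_act] will make the representation completely contractive; [invariant_ge] and
    [invariant_le] bound the test functionals and test vectors that recover the norm. *)
Record invariant_form n (w : 'I_n -> K) (s : qform E) : Prop := InvariantForm {
  invariant_ge : forall x, colq w x <= s x;
  invariant_le : forall (J : finType) (x : J -> E),
    mxle (fun (k : 'I_n) j => x j k) 1 -> \sum_j s (x j) <= weight w;
  invariant_act : forall (J L : finType) (x : J -> E) (a : J -> L -> A),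
    mxle a 1 -> \sum_l s (\sum_j eact (x j) (a j l)) <= \sum_j s (x j)
}.

(** The parameters are all vectors of [K^n], since cost bounds at all of them amount to a norm
    bound; [s] is compared with the cost at the given [w] only. *)
Lemma invariant_form_exists n (w : 'I_n -> K) : exists s, invariant_form w s.
Proof.
have [||s [s_ge s_le s_dom]] := @cost_minorant R E ('I_n -> K) (@colq n) (@weight _ _ n) w.
- by move=> w' x; exact: qf_ge0.
- move=> x; have [C _ xC] := mxle_exists f_isometric (fun (k : 'I_n) (_ : 'I_1) => x k).
  exists C => w'; rewrite /cost big_seq1.
  by have /(_ w') := (colq_mxleP f_isometric n (fun _ : 'I_1 => x) C).2 xC; rewrite big_ord1.
have s0 x : 0 <= s x by apply: le_trans (s_ge x); exact: qf_ge0.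
exists (minorant_qform s0 s_dom); split=> [//|J x x1|J L x a a1] /=.
  rewrite -[weight w]mul1r; have := s_le [seq x j | j <- enum J] 1.
  rewrite big_map big_enum; apply => w'; rewrite /cost big_map big_enum.
  exact: (colq_mxleP f_isometric n x 1).2.
by have := s_dom _ _ (@dominates_act n J L x a a1); rewrite big_map big_enum big_map big_enum.
Qed.

End ModuleAction.

(** * Direct sums of quadratic forms *)

Section FiniteSupport.
Variables (R : realType) (I : choiceType) (E : lmodType R).

(** The algebraic direct sum suffices, since the Hilbert space consists of functionals on it. *)
Definition finsupp_pred : {pred (I -> E)} := fun v =>
  `[< exists D : seq I, forall i, i \notin D -> v i = 0 >].

Record finsupp := FinSupp {
  finsupp_fun :> I -> E;
  _ : finsupp_fun \in finsupp_pred
}.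

HB.instance Definition _ := [isSub for finsupp_fun].
HB.instance Definition _ := [Choice of finsupp by <:].

Lemma finsupp_submod_closed : submod_closed finsupp_pred.
Proof.
split=> [|c u v /asboolP[D uD] /asboolP[D' vD']]; apply/asboolP.
  by exists [::].
exists (D ++ D') => i; rewrite mem_cat negb_or => /andP[/uD ui /vD' vi].
by rewrite !fctE ui vi scaler0 addr0.
Qed.

HB.instance Definition _ :=
  GRing.isSubmodClosed.Build R (I -> E) finsupp_pred finsupp_submod_closed.
HB.instance Definition _ := [SubChoice_isSubLmodule of finsupp by <:].

Lemma finsuppP (v : finsupp) : exists D : seq I, forall i, i \notin D -> v i = 0.
Proof. by apply/asboolP; exact: (valP v). Qed.

(** A classically chosen list containing the support; [dsum_formE] makes the choice immaterial. *)
Definition support_seq (v : finsupp) : seq I := undup (sval (cid (finsuppP v))).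

Lemma support_seqP (v : finsupp) i : i \notin support_seq v -> v i = 0.
Proof. by rewrite /support_seq; case: cid => D /= vD; rewrite mem_undup => /vD. Qed.

Lemma finsuppD (u v : finsupp) i : (u + v) i = u i + v i.
Proof. by rewrite -[LHS]/(val (u + v) i) raddfD. Qed.

Lemma finsuppZ t (v : finsupp) i : (t *: v) i = t *: v i.
Proof. by rewrite -[LHS]/(val (t *: v) i) linearZ. Qed.

Lemma finsuppN (v : finsupp) i : (- v) i = - v i.
Proof. by rewrite -[LHS]/(val (- v) i) raddfN. Qed.

Lemma finsupp0 i : (0 : finsupp) i = 0.
Proof. by rewrite -[LHS]/(val (0 : finsupp) i) raddf0. Qed.

Lemma finsupp_sum (J : finType) (F : J -> finsupp) i : (\sum_j F j) i = \sum_j F j i.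
Proof.
by apply: (big_morph (fun v : finsupp => v i)) => [u v|]; rewrite ?finsuppD ?finsupp0.
Qed.

Lemma finsupp_map_subproof (g : E -> E) (g0 : g 0 = 0) (v : finsupp) :
  (fun i => g (v i)) \in finsupp_pred.
Proof.
apply/asboolP; exists (support_seq v) => i /support_seqP ->; exact: g0.
Qed.

Definition finsupp_map g g0 v := FinSupp (@finsupp_map_subproof g g0 v).

Lemma finsupp_single_subproof (i : I) (x : E) :
  (fun j => if j == i then x else 0) \in finsupp_pred.
Proof. by apply/asboolP; exists [:: i] => j; rewrite inE => /negbTE ->. Qed.

Definition finsupp_single i x := FinSupp (finsupp_single_subproof i x).

Variable S : I -> qform E.

Definition dsum_form (v : finsupp) : R := \sum_(i <- support_seq v) S i (v i).

Lemma dsum_formE (D : seq I) (v : finsupp) : uniq D ->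
  (forall i, i \notin D -> v i = 0) -> dsum_form v = \sum_(i <- D) S i (v i).
Proof.
move=> uD vD; rewrite /dsum_form.
rewrite (bigID (mem D)) /= [X in _ + X]big1 ?addr0 => [|i /vD ->]; last exact: qf0.
rewrite [RHS](bigID (mem (support_seq v))) /=.
rewrite [X in _ = _ + X]big1 ?addr0 => [|i /support_seqP ->]; last exact: qf0.
rewrite -big_filter -[RHS]big_filter; apply: perm_big; apply: uniq_perm.
- by rewrite filter_uniq// undup_uniq.
- by rewrite filter_uniq.
- by move=> i; rewrite !mem_filter andbC.
Qed.

Lemma common_support (J : finType) (v : J -> finsupp) :
  exists2 D : seq I, uniq D & forall j i, i \notin D -> v j i = 0.
Proof.
exists (undup (flatten [seq support_seq (v j) | j <- enum J])).
  exact: undup_uniq.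
move=> j i; rewrite mem_undup => iD; apply: support_seqP; apply: contra iD => ij.
by apply/flatten_mapP; exists j; rewrite ?mem_enum.
Qed.

Lemma common_support2 (u v : finsupp) :
  exists D : seq I, [/\ uniq D, forall i, i \notin D -> u i = 0 &
    forall i, i \notin D -> v i = 0].
Proof.
have [D uD vD] := common_support (fun b : bool => if b then u else v).
by exists D; split=> //; [exact: (vD true)|exact: (vD false)].
Qed.

Lemma dsum_form_ge0 v : 0 <= dsum_form v.
Proof. by rewrite sumr_ge0// => i _; rewrite qf_ge0. Qed.

Lemma dsum_formZ t v : dsum_form (t *: v) = t ^+ 2 * dsum_form v.
Proof.
have [D [uD vD _]] := common_support2 v v.
rewrite (dsum_formE uD vD) (dsum_formE (D := D))//.
  by rewrite mulr_sumr; apply: eq_bigr => i _; rewrite finsuppZ qfZ.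
by move=> i /vD vi; rewrite finsuppZ vi scaler0.
Qed.

Lemma dsum_form_parallelogram u v :
  dsum_form (u + v) + dsum_form (u - v) = 2 * dsum_form u + 2 * dsum_form v.
Proof.
have [D [uD uD0 vD0]] := common_support2 u v.
rewrite (dsum_formE uD uD0) (dsum_formE uD vD0) !(dsum_formE (D := D))//; last 2 first.
- by move=> i iD; rewrite finsuppD finsuppN uD0// vD0// subrr.
- by move=> i iD; rewrite finsuppD uD0// vD0// addr0.
rewrite -big_split !mulr_sumr -big_split; apply: eq_bigr => i _.
rewrite !finsuppD finsuppN; exact: qf_parallelogram.
Qed.

Definition dsum_qform : qform finsupp :=
  QForm dsum_form_ge0 dsum_formZ dsum_form_parallelogram.

Lemma le_dsum_qform (v : finsupp) i : S i (v i) <= dsum_qform v.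
Proof.
have [iD|/support_seqP ->] := boolP (i \in support_seq v); last by rewrite qf0 qf_ge0.
rewrite /= /dsum_form (bigD1_seq i)//= ?undup_uniq// lerDl.
by rewrite sumr_ge0// => j _; rewrite qf_ge0.
Qed.

Lemma dsum_qform_single i x : dsum_qform (finsupp_single i x) = S i x.
Proof.
rewrite /= (dsum_formE (D := [:: i]))//=; first by rewrite big_seq1 eqxx.
by move=> j; rewrite inE => /negbTE ->.
Qed.

Lemma dsum_qform_le (J L : finType) (u : J -> finsupp) (v : L -> finsupp) :
  (forall i, \sum_j S i (u j i) <= \sum_l S i (v l i)) ->
  \sum_j dsum_qform (u j) <= \sum_l dsum_qform (v l).
Proof.
move=> uv; have [D uD D0] := common_support
  (fun t : J + L => match t with inl j => u j | inr l => v l end).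
have -> : \sum_j dsum_qform (u j) = \sum_j \sum_(i <- D) S i (u j i).
  by apply: eq_bigr => j _; exact: (dsum_formE uD (D0 (inl j))).
have -> : \sum_l dsum_qform (v l) = \sum_l \sum_(i <- D) S i (v l i).
  by apply: eq_bigr => l _; exact: (dsum_formE uD (D0 (inr l))).
by rewrite exchange_big [leRHS]exchange_big; apply: ler_sum => i _.
Qed.

End FiniteSupport.

(** * The representation on the dual of the direct sum *)

Section Representation.
Variables (R : realType) (A : completeNormedModType R) (nA : mxnorms R A).
Variables (K : hilbertSpace R) (f : {linear A -> bop K}).
Hypothesis f_isometric : completely_isometric nA (@opnorm R K) f.
Hypothesis nA_norm : forall a, norm1 nA a = `|a|.
Variable mul : {bilinear A -> A -> A}.
Hypothesis mulA : associative mul.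
Hypothesis mul_unital : approximately_unital mul.
Hypothesis matrix_algebras : matrix_banach_algebras mul nA.
Local Notation mxle := (mxle f).
Local Notation E := (nat -> A).
Local Notation colq := (colq f_isometric).

(* One column index for each pair of a size and a vector at which the norm of a
   matrix over [A] can be attained. *)
Local Notation Idx := {n : nat & 'I_n -> K}.

Let form_exists n (w : 'I_n -> K) :=
  invariant_form_exists f_isometric nA_norm mul_unital matrix_algebras w.

Let S (i : Idx) : qform E := sval (cid (form_exists (tagged i))).

Let SP i : invariant_form f_isometric mul (tagged i) (S i) :=
  svalP (cid (form_exists (tagged i))).

Let V := finsupp Idx E.
Let s : qform V := dsum_qform S.

Let eact0 a : eact mul 0 a = 0.
Proof. by apply/funext => k; exact: linear0l. Qed.

Let vact (v : V) (a : A) : V := finsupp_map (g := fun x => eact mul x a) (eact0 a) v.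

Let vactE v a i k : vact v a i k = mul (v i k) a.
Proof. by []. Qed.

Let finsupp_eq (u v : V) : (forall i k, u i k = v i k) -> u = v.
Proof. by move=> uv; apply: val_inj; apply/funext => i; apply/funext => k; exact: uv. Qed.

Let vact_linear a : linear (vact ^~ a).
Proof.
move=> t u v; apply: finsupp_eq => i k; rewrite finsuppD finsuppZ.
rewrite -[RHS]/(t *: vact u a i k + vact v a i k) !vactE finsuppD finsuppZ.
exact: (linearPl mul).
Qed.

Let vactDr v t a b : vact v (t *: a + b) = t *: vact v a + vact v b.
Proof.
apply: finsupp_eq => i k; rewrite finsuppD finsuppZ.
rewrite -[RHS]/(t *: vact v a i k + vact v b i k) !vactE.
exact: linearPr.
Qed.

Let vactA v a b : vact v (mul a b) = vact (vact v a) b.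
Proof. by apply: finsupp_eq => i k; rewrite !vactE mulA. Qed.

Lemma mxle_scale (I J : finType) (x : I -> J -> A) t C :
  mxle x C -> mxle (fun i j => t *: x i j) (t ^+ 2 * C).
Proof.
move=> xC z w; have := xC z (fun i => t *: w i).
congr (2 * _ <= _ + _).
  by apply: eq_bigr => i _; apply: eq_bigr => j _; rewrite opformZ opformZr.
rewrite mulrAC [RHS]mulrC !mulr_sumr; apply: eq_bigr => i _.
by rewrite normq_scale mulrCA mulrA.
Qed.

Let vact_le (J L : finType) (v : J -> V) (a : J -> L -> A) c :
  0 < c -> mxle a (c ^+ 2) ->
  \sum_l s (\sum_j vact (v j) (a j l)) <= c ^+ 2 * \sum_j s (v j).
Proof.
move=> c0 ac; pose b j l := c^-1 *: a j l.
have b1 : mxle b 1.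
  have := mxle_scale c^-1 ac; rewrite exprVn mulVf//.
  by rewrite gt_eqF// exprn_gt0.
have -> : \sum_l s (\sum_j vact (v j) (a j l)) =
    c ^+ 2 * \sum_l s (\sum_j vact (v j) (b j l)).
  rewrite mulr_sumr; apply: eq_bigr => l _; rewrite -qfZ scaler_sumr; congr (s _).
  apply: eq_bigr => j _; have := vactDr (v j) c (b j l) 0.
  rewrite addr0 scalerA mulfV ?gt_eqF// scale1r => ->.
  have -> : vact (v j) 0 = 0.
    by apply: finsupp_eq => i k; rewrite vactE finsupp0; exact: linear0r.
  by rewrite addr0.
rewrite ler_wpM2l ?sqr_ge0//; apply: dsum_qform_le => i.
have := invariant_act (SP i) (fun j => v j i) b1.
congr (_ <= _); apply: eq_bigr => l _; congr (S i _).
by rewrite finsupp_sum.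
Qed.

(** [dual_le_norm] at [u / r ^+ 2], multiplied by [r ^+ 2]: this shape absorbs an estimate
    [s u <= r ^+ 2 * s v]. *)
Let dual_scaled (phi : dual s) u r : 0 < r ->
  2 * phi u - s u / r ^+ 2 <= r ^+ 2 * `|phi| ^+ 2.
Proof.
move=> r0; have [l _] := dualP phi; have := dual_le_norm phi ((r ^+ 2)^-1 *: u).
have r2 : 0 < r ^+ 2 by rewrite exprn_gt0.
rewrite qfZ (scalarZ _ _ l) -(ler_pM2l r2) => h.
have -> : 2 * phi u - s u / r ^+ 2 =
  r ^+ 2 * (2 * ((r ^+ 2)^-1 * phi u) - (r ^+ 2)^-1 ^+ 2 * s u).
  by field; rewrite gt_eqF.
exact: h.
Qed.

Let mxle_const a r : `|a| <= r -> mxle (fun _ _ : 'I_1 => a) (r ^+ 2).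
Proof.
move=> ar; have r0 : 0 <= r by apply: le_trans ar.
have /(nA_leP f_isometric _ r0) : @nA 1%N (const_mx a) <= r.
  by rewrite -[nA _]/(norm1 nA a) nA_norm.
by apply: eq_mxle => i j; rewrite mxE.
Qed.

Let vact_le1 v a r : 0 < r -> `|a| <= r -> s (vact v a) <= r ^+ 2 * s v.
Proof.
move=> r0 /mxle_const ar; have := vact_le (fun=> v) r0 ar.
by rewrite !big_ord1.
Qed.

(** The transpose of a right action is a left action, so [pi] below preserves the order of
    products. *)
Let pi_fun a (phi : dual s) : V -> R^o := fun v => phi (vact v a).

Let pi_bound a phi r v : 0 < r -> `|a| <= r ->
  2 * pi_fun a phi v - s v <= (r * `|phi|) ^+ 2.
Proof.
move=> r0 ar; rewrite exprMn; apply: le_trans (dual_scaled phi (vact v a) r0).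
have r2 : 0 < r ^+ 2 by rewrite exprn_gt0.
by rewrite lerB// ler_pdivrMr// mulrC vact_le1.
Qed.

Let pi_dual a phi : pi_fun a phi \in dual_pred s.
Proof.
apply/asboolP; split.
  by move=> t u v; rewrite /pi_fun vact_linear; have [l _] := dualP phi; rewrite l.
exists (((`|a| + 1) * `|phi|) ^+ 2) => v; apply: pi_bound; rewrite ?lerDl//.
Qed.

Let pi_op a (phi : dual_space s) : dual_space s := Dual (pi_dual a phi).

Let pi_op_bounded a : pi_op a \in @bounded_linear_pred R (dual_space s).
Proof.
apply/asboolP; split.
  move=> t phi psi; apply: val_inj; apply/funext => v.
  by rewrite -[LHS]/(dual_fun (t *: phi + psi) (vact v a)) [RHS]dual_spaceE dual_spaceE.
exists (`|a| + 1) => phi; apply: dual_norm_le => [|v].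
  by rewrite mulr_ge0// addr_ge0.
by apply: pi_bound; rewrite ?lerDl// ltr_wpDl.
Qed.

Let pi a : bop (dual_space s) := Bop (pi_op_bounded a).

Let pi_linear : linear pi.
Proof.
move=> t a b; apply: bop_ext => phi; rewrite bop_addE bop_scaleE.
apply: val_inj; apply/funext => v; rewrite [RHS]dual_spaceE /= /pi_fun vactDr.
by have [l _] := dualP phi; rewrite l.
Qed.

HB.instance Definition _ := GRing.isLinear.Build R A (bop (dual_space s)) *:%R pi pi_linear.

Let pi_mul a b phi : pi (mul a b) phi = pi a (pi b phi).
Proof. by apply: val_inj; apply/funext => v; rewrite /= /pi_fun vactA. Qed.

(** By duality: pairing [pi x] applied to [z] with a row [v] is pairing [z] with the row [v x], and
    [vact_le] bounds the total form of [v x] by [r ^+ 2] times that of [v]. *)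
Let pi_mx_le n (x : 'M[A]_n) r : 0 < r -> nA x <= r ->
  opnorm (map_mx pi x) <= r.
Proof.
move=> r0 xr; apply: opnorm_le => [|z]; first exact: ltW.
have r2 : 0 < r ^+ 2 by rewrite exprn_gt0.
rewrite -ler_sqr ?nnegrE ?mulr_ge0 ?l2norm_ge0 ?(ltW r0)//.
rewrite exprMn [leLHS]l2norm_sqr l2norm_sqr.
pose zz j : dual s := z j ord0.
pose Tz i : dual s := mxop (map_mx pi x) z i ord0.
have TzE i v : Tz i v = \sum_j zz j (vact v (x i j)).
  by rewrite /Tz mxE dual_space_sumE; apply: eq_bigr => j _; rewrite mxE.
rewrite (eq_bigr (fun i => conjq s (Tz i))) => [|i _]; last exact: dual_norm_sqr.
apply: sum_conjq_le => [i|v]; first by have [_] := dualP (Tz i).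
pose u j := \sum_i vact (v i) (x i j).
have -> : \sum_i (2 * Tz i (v i) - s (v i)) =
    \sum_j 2 * zz j (u j) - \sum_i s (v i).
  rewrite sumrB; congr (_ - _); rewrite -!mulr_sumr; congr (_ * _).
  rewrite (eq_bigr (fun i => \sum_j zz j (vact (v i) (x i j)))) => [|i _]; last exact: TzE.
  rewrite exchange_big; apply: eq_bigr => j _ /=.
  by have [l _] := dualP (zz j); rewrite -scalar_sum.
have xr' : mxle x (r ^+ 2) by apply/(nA_leP f_isometric _ (ltW r0)).
have su : (\sum_j s (u j)) / r ^+ 2 <= \sum_i s (v i).
  by rewrite ler_pdivrMr// mulrC; exact: vact_le.
apply: le_trans (_ : \sum_j (2 * zz j (u j) - s (u j) / r ^+ 2) <= _).
  by rewrite sumrB lerB// -mulr_suml.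
by rewrite mulr_sumr; apply: ler_sum => j _; exact: dual_scaled.
Qed.

Let pi_le n (x : 'M[A]_n) : opnorm (map_mx pi x) <= nA x.
Proof.
apply/ler_addgt0Pr => e e0; apply: pi_mx_le; last by rewrite lerDl ltW.
by rewrite ltr_wpDl// (nA_ge0 f_isometric).
Qed.

Let le_pi n (x : 'M[A]_n) : nA x <= opnorm (map_mx pi x).
Proof.
apply/ler_addgt0Pr => e e0; set r := opnorm _ + e.
have or : opnorm (map_mx pi x) <= r by rewrite lerDl ltW.
have r0 : 0 < r by rewrite ltr_wpDl// opnorm_ge0.
have r2 : 0 < r ^+ 2 by rewrite exprn_gt0.
apply/(nA_leP f_isometric _ (ltW r0)).
(* By the approximate unit it is enough to bound the pairing of [e * x] with
   [z] and [w]; that pairing is read off on multiples of the columns of the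
   diagonal matrix [e]. *)
suff main (u : A) : `|u| <= 1 -> mxle (fun i j => mul u (x i j)) (r ^+ 2).
  apply: (mxle_approx f_isometric nA_norm) => d d0.
  have [u u1 uP] := approx_unit mul_unital (fun ij => x ij.1 ij.2) d0.
  by exists (fun i j => mul u (x i j)); [exact: main|move=> i j; exact: (uP (i, j)).1].
move=> u1 z w; pose i0 : Idx := Tagged (fun n => 'I_n -> K) w.
have S_ge y t : 2 * colform f w y t - `|t| ^+ 2 <= S i0 y.
  exact: le_trans (colq_ub f_isometric w y t) (invariant_ge (SP i0) y).
(* Vector functionals living on the component of [w]; [invariant_ge] makes the norm of the [j]-th at
   most that of [z j]. *)
pose phi_fun (j : 'I_n) : V -> R^o := fun v => colform f w (v i0) (z j).
have phi_le j v : 2 * phi_fun j v - s v <= `|z j| ^+ 2.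
  have := S_ge (v i0) (z j); have : S i0 (v i0) <= s v by exact: le_dsum_qform.
  by rewrite /phi_fun; lra.
have phi_dual j : phi_fun j \in dual_pred s.
  apply/asboolP; split; last by exists (`|z j| ^+ 2); exact: phi_le.
  move=> t a b; rewrite /phi_fun finsuppD finsuppZ /colform mulr_sumr -big_split.
  apply: eq_bigr => k _ /=.
  by rewrite -[X in opform f X]/(t *: a i0 k + b i0 k) opformD opformZ.
pose phi : 'cV[dual_space s]_n := \col_j Dual (phi_dual j).
have phi_norm : l2norm phi ^+ 2 <= \sum_j `|z j| ^+ 2.
  rewrite l2norm_sqr; apply: ler_sum => j _; rewrite mxE dual_space_normE.
  by apply: conjq_le; exact: phi_le.
have Tphi : l2norm (mxop (map_mx pi x) phi) ^+ 2 <= r ^+ 2 * \sum_j `|z j| ^+ 2.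
  apply: (@le_trans _ _ (r ^+ 2 * l2norm phi ^+ 2)); last by rewrite ler_wpM2l// ltW.
  rewrite -exprMn lerXn2r ?nnegrE ?mulr_ge0 ?l2norm_ge0 ?(ltW r0)//.
  by apply: le_trans (mxop_le _ _) _; rewrite ler_wpM2r// l2norm_ge0.
pose y (k : 'I_n) : E := fun l => if val k == l then u else 0.
(* By [invariant_le] the columns of the diagonal of [u] have total form at most [weight w]. The
   factor [r ^+ 2] turns the dual bound into [r ^+ 2] times the inequality to be proved. *)
pose v k : V := finsupp_single i0 (r ^+ 2 *: y k).
have sv : \sum_k s (v k) <= (r ^+ 2) ^+ 2 * weight w.
  rewrite (eq_bigr (fun k => (r ^+ 2) ^+ 2 * S i0 (y k))) => [|k _]; last first.
    by rewrite -qfZ; exact: dsum_qform_single.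
  rewrite -mulr_sumr ler_wpM2l ?sqr_ge0//; apply: (invariant_le (SP i0)).
  have := mxle_diag f_isometric (_ : norm1 nA u <= 1) (I := 'I_n).
  rewrite nA_norm => /(_ u1); apply: eq_mxle => i j.
  by rewrite /y eq_sym.
have Tv k : 2 * dual_fun (mxop (map_mx pi x) phi k ord0) (v k) - s (v k) <=
    `|mxop (map_mx pi x) phi k ord0| ^+ 2 by exact: dual_le_norm.
have TvE k : dual_fun (mxop (map_mx pi x) phi k ord0) (v k) =
    r ^+ 2 * \sum_j opform f (mul u (x k j)) (z j) (w k).
  rewrite mxE dual_space_sumE mulr_sumr; apply: eq_bigr => j _; rewrite !mxE /=.
  rewrite /pi_fun /= /phi_fun /colform (bigD1 k)//= big1 ?addr0 => [|l lk].
    rewrite /eact eqxx -[X in mul X _]/(r ^+ 2 *: y k k) /y eqxx.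
    by rewrite linearZl_LR opformZ.
  rewrite /eact eqxx -[X in mul X _]/(r ^+ 2 *: y k l) /y.
  rewrite (negbTE (_ : val k != val l)); last by rewrite eq_sym.
  by rewrite scaler0 linear0l opform0.
have h : \sum_k (2 * dual_fun (mxop (map_mx pi x) phi k ord0) (v k) - s (v k)) <=
    l2norm (mxop (map_mx pi x) phi) ^+ 2.
  by rewrite l2norm_sqr; apply: ler_sum => k _; exact: Tv.
rewrite sumrB in h.
rewrite -(ler_pM2l r2).
have <- : \sum_k 2 * dual_fun (mxop (map_mx pi x) phi k ord0) (v k) =
    r ^+ 2 * (2 * \sum_i \sum_j opform f (mul u (x i j)) (z j) (w i)).
  rewrite mulrCA !mulr_sumr; apply: eq_bigr => k _.
  by rewrite TvE.
have -> : r ^+ 2 * (\sum_j `|z j| ^+ 2 + r ^+ 2 * \sum_i `|w i| ^+ 2) =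
    r ^+ 2 * (\sum_j `|z j| ^+ 2) + (r ^+ 2) ^+ 2 * weight w.
  by rewrite /weight; ring.
by rewrite lerBlDr in h; apply: le_trans h _; exact: lerD.
Qed.

Lemma operator_algebra_of_matrix_algebras : real_operator_algebra mul nA.
Proof.
exists (dual_space s), pi; split=> [n x|a b phi]; last exact: pi_mul.
by apply/le_anti; rewrite pi_le le_pi.
Qed.

End Representation.

(** [pi] turns the matrix product into composition of operators on [H^n], for which the operator
    norm is submultiplicative. *)
Lemma matrix_algebras_of_operator_algebra (R : realType) (A : completeNormedModType R)
    (nA : mxnorms R A) (mul : {bilinear A -> A -> A}) :
  real_operator_algebra mul nA -> matrix_banach_algebras mul nA.
Proof.
move=> [H [pi [pi_iso pi_mul]]] n a b; rewrite -!pi_iso.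
have mulE v : mxop (map_mx pi (mxalg_mul mul a b)) v =
    mxop (map_mx pi a) (mxop (map_mx pi b) v).
  apply/matrixP => i j; rewrite !mxE.
  have -> : \sum_j0 map_mx pi (mxalg_mul mul a b) i j0 (v j0 ord0) =
      \sum_l \sum_k pi (a i k) (pi (b k l) (v l ord0)).
    apply: eq_bigr => l _; rewrite !mxE.
    apply: (etrans (y := \sum_k pi (mul (a i k) (b k l)) (v l ord0))).
      rewrite linear_sum.
      by apply: (big_morph (fun T : bop H => T (v l ord0))) => [S T|]; rewrite ?bop_addE ?bop_0E.
    by apply: eq_bigr => k _; rewrite pi_mul.
  rewrite exchange_big; apply: eq_bigr => k _ /=; rewrite !mxE.
  rewrite (big_morph (pi (a i k)) (bopD _) (bop0 _)).
  by apply: eq_bigr => l _; rewrite mxE.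
apply: opnorm_le => [|v]; first by rewrite mulr_ge0 ?opnorm_ge0.
rewrite mulE (le_trans (mxop_le _ _))// -mulrA ler_wpM2l ?opnorm_ge0//.
exact: mxop_le.
Qed.

(** * Haagerup norms on the algebraic tensor product *)

Section HaagerupNorm.
Variables (R : realType) (A : completeNormedModType R) (nA : mxnorms R A).
Variables (K : hilbertSpace R) (f : {linear A -> bop K}).
Hypothesis f_isometric : completely_isometric nA (@opnorm R K) f.
Local Notation mxle := (mxle f).
Local Notation T := (tensor A A).
Local Notation hn := (haagerup_norm nA nA).

Lemma tensZl c (x y : A) : tens (c *: x) y = c *: tens x y.
Proof. by apply: val_inj; rewrite linearZ /=; apply/funext => phi; rewrite linearZl_LR. Qed.

Lemma tensZr c (x y : A) : tens x (c *: y) = c *: tens x y.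
Proof. by apply: val_inj; rewrite linearZ /=; apply/funext => phi; rewrite linearZr_LR. Qed.

Lemma tens0l (y : A) : tens (0 : A) y = 0.
Proof. by rewrite -(scale0r (0 : A)) tensZl scale0r. Qed.

Lemma tens0r (x : A) : tens x (0 : A) = 0.
Proof. by rewrite -(scale0r (0 : A)) tensZr scale0r. Qed.

Lemma val_tens_sum (s : seq (A * A)) :
  val (\sum_(xy <- s) tens xy.1 xy.2) =
  \sum_(xy <- s) (fun phi : bilinear_form A A => phi xy.1 xy.2 : R^o).
Proof. by rewrite raddf_sum. Qed.

Lemma tensorP (t : T) : exists s : seq (A * A), t = \sum_(xy <- s) tens xy.1 xy.2.
Proof.
have /asboolP[s ts] : tensor_fun t \in @tensor_pred R A A by exact: (valP t).
by exists s; apply: val_inj; rewrite val_tens_sum.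
Qed.

Lemma mxle_mono (I J : finType) (x : I -> J -> A) C D :
  C <= D -> mxle x C -> mxle x D.
Proof.
move=> CD xC z w; apply: le_trans (xC z w) _; rewrite lerD2l ler_wpM2r//.
by rewrite sumr_ge0// => i _; rewrite sqr_ge0.
Qed.

(** This is [[x y] [x y]^* = x x^* + y y^*]. *)
Lemma mxle_row m n p (x : 'M[A]_(m, n)) (y : 'M[A]_(m, p)) C D :
  mxle x C -> mxle y D -> mxle (row_mx x y) (C + D).
Proof.
move=> xC yD z w; have := xC (fun j => z (lshift p j)) w; have := yD (fun j => z (rshift n j)) w.
have -> : \sum_i \sum_j opform f (row_mx x y i j) (z j) (w i) =
    \sum_i \sum_j opform f (x i j) (z (lshift p j)) (w i) +
    \sum_i \sum_j opform f (y i j) (z (rshift n j)) (w i).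
  rewrite -big_split; apply: eq_bigr => i _ /=; rewrite big_split_ord /=.
  by congr (_ + _); apply: eq_bigr => j _; rewrite ?row_mxEl ?row_mxEr.
by rewrite (big_split_ord _ _ (fun k => `|z k| ^+ 2)) /= mulrDl; lra.
Qed.

(** The column counterpart, from [x^* x + y^* y]. Here the vector [z] is shared by both blocks, so
    its square is split in the ratio of [C] to [D] by rescaling [z], which is where positivity
    enters. *)
Lemma mxle_col m n p (x : 'M[A]_(m, n)) (y : 'M[A]_(p, n)) C D : 0 < C -> 0 < D ->
  mxle x C -> mxle y D -> mxle (col_mx x y) (C + D).
Proof.
move=> C0 D0 xC yD z w.
have scaled q (u : 'M[A]_(q, n)) E v : 0 < E -> mxle u E ->
    2 * \sum_i \sum_j opform f (u i j) (z j) (v i) <=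
    E / (C + D) * \sum_j `|z j| ^+ 2 + (C + D) * \sum_i `|v i| ^+ 2.
  move=> E0 uE; pose t := E / (C + D); have t0 : 0 < t by rewrite divr_gt0//; lra.
  have := uE (fun j => t *: z j) v.
  have -> : \sum_i \sum_j opform f (u i j) (t *: z j) (v i) =
      t * \sum_i \sum_j opform f (u i j) (z j) (v i).
    rewrite mulr_sumr; apply: eq_bigr => i _; rewrite mulr_sumr; apply: eq_bigr => j _.
    by rewrite opformZm.
  have -> : \sum_j `|t *: z j| ^+ 2 = t ^+ 2 * \sum_j `|z j| ^+ 2.
    by rewrite mulr_sumr; apply: eq_bigr => j _; rewrite normq_scale.
  rewrite mulrCA => h; rewrite -(ler_pM2l t0) -/t; apply: le_trans h _.
  have -> : E = t * (C + D) by rewrite /t divfK//; lra.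
  by rewrite le_eqVlt; apply/orP; left; apply/eqP; rewrite -/t; ring.
have := scaled _ x C (fun j => w (lshift p j)) C0 xC; have := scaled _ y D (fun j => w (rshift m j)) D0 yD.
have -> : \sum_i \sum_j opform f (col_mx x y i j) (z j) (w i) =
    \sum_i \sum_j opform f (x i j) (z j) (w (lshift p i)) +
    \sum_i \sum_j opform f (y i j) (z j) (w (rshift m i)).
  rewrite big_split_ord /=; congr (_ + _).
    by apply: eq_bigr => i _; apply: eq_bigr => j _; rewrite col_mxEu.
  by apply: eq_bigr => i _; apply: eq_bigr => j _; rewrite col_mxEd.
rewrite (big_split_ord _ _ (fun k => `|w k| ^+ 2)) /=.
set Z := \sum_j `|z j| ^+ 2.
have : Z = C / (C + D) * Z + D / (C + D) * Z by field; lra.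
move: (C / (C + D) * Z) (D / (C + D) * Z) => a b ->.
by rewrite !mulrDr; lra.
Qed.

Lemma odotD n p q (x : 'M[A]_(n, p)) (y : 'M[A]_(p, n)) (x' : 'M[A]_(n, q))
    (y' : 'M[A]_(q, n)) :
  odot x y + odot x' y' = odot (row_mx x x') (col_mx y y').
Proof.
apply/matrixP => i j; rewrite !mxE big_split_ord /=.
congr (_ + _); apply: eq_bigr => k _.
  by rewrite row_mxEl col_mxEu.
by rewrite row_mxEr col_mxEd.
Qed.

(** Both factors carry the same bound on the squared norm, so the product of the norms is at most
    [rho], and [rho] is additive when factors are concatenated. *)
Definition haagerup_le n (t : 'M[T]_n) (rho : R) := exists p,
  exists (x : 'M[A]_(n, p)) (y : 'M[A]_(p, n)),
    [/\ t = odot x y, mxle x rho & mxle y rho].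

Lemma haagerup_leD n (t u : 'M[T]_n) rho sigma : 0 < rho -> 0 < sigma ->
  haagerup_le t rho -> haagerup_le u sigma -> haagerup_le (t + u) (rho + sigma).
Proof.
move=> r0 s0 [p [x [y [-> xr yr]]]] [q [x' [y' [-> xs ys]]]].
exists (p + q)%N, (row_mx x x'), (col_mx y y').
by rewrite odotD; split=> //; [exact: mxle_row|exact: mxle_col].
Qed.

Lemma haagerup_le0 n rho : 0 <= rho -> haagerup_le (0 : 'M[T]_n) rho.
Proof.
move=> r0; exists 0%N, (\matrix_(i, j) 0), (\matrix_(i, j) 0); split.
- by apply/matrixP => i j; rewrite !mxE big_ord0.
- move=> z w; rewrite big1 ?mulr0 => [|i _]; last by rewrite big_ord0.
  by rewrite big_ord0 add0r mulr_ge0// sumr_ge0// => i _; rewrite sqr_ge0.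
- move=> z w; rewrite big_ord0 mulr0 big_ord0 mulr0 addr0.
  by rewrite sumr_ge0// => i _; rewrite sqr_ge0.
Qed.

Lemma haagerup_le_sum (I : finType) n (t : I -> 'M[T]_n) rho e : 0 < e ->
  (forall i, 0 < rho i /\ haagerup_le (t i) (rho i)) ->
  haagerup_le (\sum_i t i) (\sum_i rho i + e).
Proof.
move=> e0 h; suff [] : 0 < \sum_i rho i + e /\ haagerup_le (\sum_i t i) (\sum_i rho i + e).
  by [].
(* The bound [e] serves the empty sum, since [haagerup_leD] asks for positive bounds. *)
rewrite unlock /= /reducebig; elim: (index_enum I) => [|i r [IH1 IH2]] /=.
  by rewrite add0r; split=> //; exact/haagerup_le0/ltW.
have [r0 hi] := h i; rewrite -addrA; split; first exact: addr_gt0.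
exact: haagerup_leD.
Qed.

Definition single_mx n (i j : 'I_n) (u : T) : 'M[T]_n :=
  \matrix_(a, b) (if (a == i) && (b == j) then u else 0).

Lemma sum_single_mx n (t : 'M[T]_n) :
  t = \sum_(ij : 'I_n * 'I_n) single_mx ij.1 ij.2 (t ij.1 ij.2).
Proof.
apply/matrixP => a b; rewrite summxE (bigD1 (a, b))//= mxE !eqxx big1 ?addr0//.
move=> [i j] /= ne; rewrite mxE /=; case: (a =P i) => [ai|//] /=.
by case: (b =P j) => [bj|//]; rewrite ai bj eqxx in ne.
Qed.

Lemma haagerup_le_single n (i j : 'I_n) u rho : 0 <= rho ->
  haagerup_le (const_mx u : 'M[T]_1) rho -> haagerup_le (single_mx i j u) rho.
Proof.
move=> r0 [p [x [y [uE xr yr]]]].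
exists p, (\matrix_(a, k) (if a == i then x ord0 k else 0)).
exists (\matrix_(k, b) (if b == j then y k ord0 else 0)); split.
- have /matrixP/(_ ord0 ord0) := uE; rewrite !mxE => ->.
  apply/matrixP => a b; rewrite !mxE.
  have [ai|ai] /= := eqVneq a i; last first.
    by rewrite big1// => k _; rewrite !mxE (negbTE ai) tens0l.
  have [bj|bj] /= := eqVneq b j; last first.
    by rewrite big1// => k _; rewrite !mxE (negbTE bj) tens0r.
  by apply: eq_bigr => k _; rewrite !mxE ai bj !eqxx.
- move=> z w; have := xr z (fun=> w i); rewrite !big_ord1.
  rewrite (bigD1 i)//= [X in 2 * (_ + X)]big1 ?addr0 => [|a /negbTE ai]; last first.
    by rewrite big1// => k _; rewrite mxE ai opform0.
  have -> : \sum_k opform f ((\matrix_(a, k) (if a == i then x ord0 k else 0) : 'M[A]_(n, p)) i k) (z k) (w i) =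
      \sum_k opform f (x ord0 k) (z k) (w i).
    by apply: eq_bigr => k _; rewrite mxE eqxx.
  move/le_trans; apply; rewrite lerD2l ler_wpM2l// (bigD1 i)//= lerDl.
  by rewrite sumr_ge0// => a _; rewrite sqr_ge0.
- move=> z w; have := yr (fun=> z j) w; rewrite !big_ord1.
  have -> : \sum_k \sum_b opform f ((\matrix_(k, b) (if b == j then y k ord0 else 0) : 'M[A]_(p, n)) k b) (z b) (w k) =
      \sum_k \sum_(b < 1) opform f (y k b) (z j) (w k).
    apply: eq_bigr => k _; rewrite big_ord1 (bigD1 j)//= mxE eqxx big1 ?addr0//.
    by move=> b /negbTE bj; rewrite mxE bj opform0.
  move/le_trans; apply; rewrite lerD2r (bigD1 j)//= lerDl.
  by rewrite sumr_ge0// => a _; rewrite sqr_ge0.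
Qed.

Lemma haagerup_le_exists1 (u : T) :
  exists2 rho, 0 < rho & haagerup_le (const_mx u : 'M[T]_1) rho.
Proof.
have [s ->] := tensorP u.
pose x : 'M[A]_(1, size s) := \matrix_(i, k) (tnth (in_tuple s) k).1.
pose y : 'M[A]_(size s, 1) := \matrix_(k, i) (tnth (in_tuple s) k).2.
have [C C0 xC] := mxle_exists f_isometric x.
have [D D0 yD] := mxle_exists f_isometric y.
exists (C + D + 1); first lra.
exists (size s), x, y; split.
- apply/matrixP => i j; rewrite !mxE big_tnth; apply: eq_bigr => k _.
  by rewrite !mxE.
- by apply: mxle_mono xC; lra.
- by apply: mxle_mono yD; lra.
Qed.

(** Makes the set in [haagerup_norm] nonempty, so that its [inf] is a true infimum and not a default
    value. *)
Lemma haagerup_le_exists n (t : 'M[T]_n) : exists2 rho, 0 < rho & haagerup_le t rho.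
Proof.
have h (ij : 'I_n * 'I_n) : exists rho, 0 < rho /\
    haagerup_le (single_mx ij.1 ij.2 (t ij.1 ij.2)) rho.
  have [rho r0 hr] := haagerup_le_exists1 (t ij.1 ij.2).
  by exists rho; split=> //; apply: haagerup_le_single => //; exact: ltW.
have [rho rhoP] := choice h; exists (\sum_ij rho ij + 1).
  by rewrite ltr_wpDl// sumr_ge0// => ij _; have [/ltW] := rhoP ij.
by rewrite {1}[t]sum_single_mx; exact: haagerup_le_sum.
Qed.

Lemma haagerup_norm_lbound n (t : 'M[T]_n) :
  has_lbound [set r : R | exists (p : nat) (x : 'M[A]_(n, p)) (y : 'M[A]_(p, n)),
         t = odot x y /\ r = rectnorm nA x * rectnorm nA y].
Proof.
exists 0 => _ [p [x [y [_ ->]]]].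
by rewrite mulr_ge0// (rectnorm_ge0 f_isometric).
Qed.

Lemma haagerup_norm_le n (t : 'M[T]_n) rho : 0 < rho -> haagerup_le t rho -> hn t <= rho.
Proof.
move=> r0 [p [x [y [tE xr yr]]]].
apply: (@le_trans _ _ (rectnorm nA x * rectnorm nA y)).
  by apply: ge_inf; [exact: haagerup_norm_lbound|exists p, x, y].
have sq u v (z : 'M[A]_(u, v)) : mxle z rho -> rectnorm nA z <= Num.sqrt rho.
  by move=> zr; apply/(rectnorm_leP f_isometric); rewrite ?sqrtr_ge0// sqr_sqrtr// ltW.
have -> : rho = Num.sqrt rho * Num.sqrt rho by rewrite -expr2 sqr_sqrtr// ltW.
by rewrite ler_pM// ?(rectnorm_ge0 f_isometric)// sq.
Qed.

Lemma haagerup_norm_ge0 n (t : 'M[T]_n) : 0 <= hn t.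
Proof.
have [rho r0 [p [x [y [tE _ _]]]]] := haagerup_le_exists t.
apply: lb_le_inf; first by exists (rectnorm nA x * rectnorm nA y), p, x, y.
by move=> _ [q [x' [y' [_ ->]]]]; rewrite mulr_ge0// (rectnorm_ge0 f_isometric).
Qed.

(* Rescaling [x] up and [y] down equalises the two norms. *)
Lemma haagerup_le_of_lt n (t : 'M[T]_n) rho : hn t < rho -> haagerup_le t rho.
Proof.
move=> tr; have [rho' _ [p0 [x0 [y0 [tE0 _ _]]]]] := haagerup_le_exists t.
have hi : has_inf [set r : R | exists (p : nat) (x : 'M[A]_(n, p)) (y : 'M[A]_(p, n)),
         t = odot x y /\ r = rectnorm nA x * rectnorm nA y].
  split; last exact: haagerup_norm_lbound.
  by exists (rectnorm nA x0 * rectnorm nA y0), p0, x0, y0.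
have e0 : 0 < rho - hn t by rewrite subr_gt0.
have [_ [p [x [y [tE ->]]]]] := inf_adherent e0 hi.
rewrite -[inf _]/(hn t) addrC subrK => xy.
have a0 := rectnorm_ge0 f_isometric x; have b0 := rectnorm_ge0 f_isometric y.
have xa := mxle_rectnorm f_isometric x; have yb := mxle_rectnorm f_isometric y.
move: (rectnorm nA x) (rectnorm nA y) a0 b0 xa yb xy => a b a0 b0 xa yb xy.
have [a' [b' [a'0 b'0 aa' bb' ab']]] : exists a' b',
    [/\ 0 < a', 0 < b', a <= a', b <= b' & a' * b' <= rho].
  (* Either norm may be zero, so both are enlarged by [d] before their ratio is taken; [d <= 1]
     gives [(a + d) * (b + d) <= a * b + d * (a + b + 1)]. *)
  pose d := Num.min 1 ((rho - a * b) / (a + b + 1)).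
  have d0 : 0 < d by rewrite lt_min ltr01 divr_gt0//; lra.
  have d1 : d <= 1 by rewrite ge_min lexx.
  have dr : d * (a + b + 1) <= rho - a * b.
    by rewrite -ler_pdivlMr ?ge_min ?lexx ?orbT//; lra.
  exists (a + d), (b + d); split; try lra; nra.
pose l := Num.sqrt (b' / a').
have l2 : l ^+ 2 = b' / a' by rewrite sqr_sqrtr// divr_ge0// ltW.
have l0 : l != 0 by rewrite sqrtr_eq0 -ltNge divr_gt0.
exists p, (\matrix_(i, j) (l *: x i j)), (\matrix_(i, j) (l^-1 *: y i j)); split.
- rewrite tE; apply/matrixP => i j; rewrite !mxE; apply: eq_bigr => k _.
  by rewrite !mxE tensZl tensZr scalerA mulfV// scale1r.
- have := mxle_scale l xa; rewrite l2 => h.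
  apply: (eq_mxle (x := fun i j => l *: x i j)) => [i j|]; first by rewrite mxE.
  apply: mxle_mono h; apply: le_trans ab'.
  have a2 : b' * a ^+ 2 <= b' * a' ^+ 2 by rewrite ler_pM2l// lerXn2r ?nnegrE ?(ltW a'0).
  by rewrite mulrAC ler_pdivrMr//; lra.
- have := mxle_scale l^-1 yb; rewrite exprVn l2 invf_div => h.
  apply: (eq_mxle (x := fun i j => l^-1 *: y i j)) => [i j|]; first by rewrite mxE.
  apply: mxle_mono h; apply: le_trans ab'.
  have b2 : a' * b ^+ 2 <= a' * b' ^+ 2 by rewrite ler_pM2l// lerXn2r ?nnegrE ?(ltW b'0).
  by rewrite mulrAC ler_pdivrMr//; lra.
Qed.

Lemma haagerup_normD n (t u : 'M[T]_n) : hn (t + u) <= hn t + hn u.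
Proof.
apply/ler_addgt0Pr => e e0.
have t0 := haagerup_norm_ge0 t; have u0 := haagerup_norm_ge0 u.
have -> : hn t + hn u + e = (hn t + e / 2) + (hn u + e / 2) by field.
apply: haagerup_norm_le; first lra.
by apply: haagerup_leD; [lra|lra|apply: haagerup_le_of_lt; lra..].
Qed.

Lemma haagerup_normN n (t : 'M[T]_n) : hn (- t) = hn t.
Proof.
suff le (u : 'M[T]_n) : hn (- u) <= hn u.
  by apply/le_anti; rewrite le -{1}[t]opprK le.
apply/ler_addgt0Pr => e e0; have u0 := haagerup_norm_ge0 u.
apply: haagerup_norm_le; first lra.
have [|p [x [y [uE xr yr]]]] := @haagerup_le_of_lt _ u (hn u + e); first lra.
exists p, (\matrix_(i, j) (-1 *: x i j)), y; split=> //.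
  rewrite uE; apply/matrixP => i j; rewrite !mxE -sumrN; apply: eq_bigr => k _.
  by rewrite !mxE tensZl scaleN1r.
have := mxle_scale (-1) xr; rewrite sqrrN expr1n mul1r.
by apply: eq_mxle => i j; rewrite mxE.
Qed.

Lemma haagerup_norm_entries n (t : 'M[T]_n) :
  hn t <= \sum_(ij : 'I_n * 'I_n) norm1 hn (t ij.1 ij.2).
Proof.
have single (i j : 'I_n) u : hn (single_mx i j u) <= norm1 hn u.
  apply/ler_addgt0Pr => e e0; have u0 := haagerup_norm_ge0 (const_mx u : 'M[T]_1).
  have ue : 0 < norm1 hn u + e by rewrite ltr_wpDl.
  apply: haagerup_norm_le => //; apply: haagerup_le_single; first exact: ltW.
  by apply: haagerup_le_of_lt; rewrite ltrDl.
have h0 : hn (0 : 'M[T]_n) <= 0.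
  apply/ler_addgt0Pr => e e0; rewrite add0r; apply: haagerup_norm_le => //.
  exact/haagerup_le0/ltW.
rewrite {1}[t]sum_single_mx; elim/big_ind2 : _ => // a x b y ax bY.
by rewrite (le_trans (haagerup_normD _ _))// lerD.
Qed.

(** Makes [hn] at each size uniformly continuous in the entries, hence compatible with limits in the
    completion, which are taken entry by entry. *)
Lemma haagerup_norm_dist n (t u : 'M[T]_n) :
  `|hn t - hn u| <= \sum_(ij : 'I_n * 'I_n) norm1 hn (t ij.1 ij.2 - u ij.1 ij.2).
Proof.
have -> : \sum_(ij : 'I_n * 'I_n) norm1 hn (t ij.1 ij.2 - u ij.1 ij.2) =
    \sum_(ij : 'I_n * 'I_n) norm1 hn ((t - u) ij.1 ij.2).
  by apply: eq_bigr => ij _; rewrite !mxE.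
apply: le_trans (haagerup_norm_entries _).
have h1 : hn t <= hn u + hn (t - u) by rewrite -{1}(subrK u t) addrC haagerup_normD.
have h2 : hn u <= hn t + hn (u - t) by rewrite -{1}(subrK t u) addrC haagerup_normD.
by rewrite -(opprB t u) haagerup_normN in h2; rewrite ler_norml; lra.
Qed.

Lemma haagerup_norm1_ge0 (u : T) : 0 <= norm1 hn u.
Proof. exact: haagerup_norm_ge0. Qed.

Lemma haagerup_norm10 : norm1 hn (0 : T) = 0.
Proof.
apply/le_anti; rewrite haagerup_norm1_ge0 andbT; apply/ler_addgt0Pr => e e0.
rewrite add0r; apply: haagerup_norm_le => //.
have -> : const_mx 0 = 0 :> 'M[T]_1 by apply/matrixP => i j; rewrite !mxE.
exact/haagerup_le0/ltW.
Qed.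

End HaagerupNorm.

Lemma cvg_sumr (R : realType) (I : finType) (F : I -> nat -> R) (l : I -> R) :
  (forall i, F i k @[k --> \oo] --> l i) ->
  \sum_i F i k @[k --> \oo] --> \sum_i l i.
Proof.
move=> Fl; rewrite (_ : (fun k => _) = \sum_i F i); last first.
  by apply/funext => k; rewrite fct_sumE.
elim/big_ind2 : _ => // [|a G b H aG bH]; first exact: cvg_cst.
exact: cvgD.
Qed.

(** * Multiplication on the completed Haagerup tensor product *)

Section HaagerupMultiplication.
Variables (R : realType) (A : completeNormedModType R) (nA : mxnorms R A).
Variables (K : hilbertSpace R) (f : {linear A -> bop K}).
Hypothesis f_isometric : completely_isometric nA (@opnorm R K) f.
Hypothesis nA_norm : forall a, norm1 nA a = `|a|.
Variable mul : {bilinear A -> A -> A}.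
Local Notation mxle := (mxle f).
Local Notation T := (tensor A A).
Local Notation hn := (haagerup_norm nA nA).
Local Notation HT := (haagerup nA nA).

Lemma constant_cauchy (u : T) : norm_cauchy hn (fun=> u).
Proof.
by move=> e e0; exists 0%N => k l _ _; rewrite subrr (haagerup_norm10 f_isometric).
Qed.

(** The canonical map from the algebraic tensor product to its completion. *)
Definition constant_class (u : T) : HT :=
  Completion (ex_intro2 _ _ (fun=> u) (constant_cauchy u) erefl).

Lemma constant_classP (u : T) : converges_to (fun=> u) (constant_class u).
Proof.
split; first exact: constant_cauchy.
rewrite (_ : (fun k => _) = (fun=> 0)); first exact: cvg_cst.
by apply/funext => k; rewrite subrr (haagerup_norm10 f_isometric).
Qed.

Lemma completion_repr_cauchy (z : HT) : norm_cauchy hn (completion_repr z).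
Proof. by rewrite /completion_repr; case: cid2. Qed.

Lemma converges_to_repr (u : nat -> T) (z : HT) : converges_to u z ->
  norm1 hn (completion_repr z k - u k) @[k --> \oo] --> (0 : R).
Proof.
rewrite /converges_to /completion_repr; case: cid2 => r /= rc ->.
by case.
Qed.

Lemma repr_converges_to (z : HT) : converges_to (completion_repr z) z.
Proof.
rewrite /converges_to /completion_repr; case: cid2 => r /= rc ->; split=> //.
rewrite (_ : (fun k => _) = (fun=> 0)); first exact: cvg_cst.
by apply/funext => k; rewrite subrr (haagerup_norm10 f_isometric).
Qed.

Lemma haagerup_norm_cvg n (t : nat -> 'M[T]_n) (u : 'M[T]_n) :
  (forall i j, norm1 hn (t k i j - u i j) @[k --> \oo] --> (0 : R)) ->
  hn (t k) @[k --> \oo] --> hn u.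
Proof.
move=> tu; apply/cvgrPdist_le => e e0.
have := cvg_sumr (fun ij : 'I_n * 'I_n => tu ij.1 ij.2).
rewrite big1// => /cvgr0_norm_le/(_ e e0); apply: filterS => k ke.
rewrite distrC; apply: le_trans (haagerup_norm_dist f_isometric _ _) _.
exact: le_trans (ler_norm _) ke.
Qed.

(** [odot a b] multiplies out to the matrix product of [a] and [b], and the factors [a], [b]
    themselves bound its Haagerup norm by [nA a * nA b]. *)
Lemma matrix_algebras_of_haagerup :
  haagerup_multiplication_cc mul nA -> matrix_banach_algebras mul nA.
Proof.
move=> [m [[m_lin m_tens] m_cc]] n a b.
have mD (u v : T) : m (constant_class (u + v)) = m (constant_class u) + m (constant_class v).
  rewrite (m_lin 1 (fun=> u) (fun=> v) (constant_class u) (constant_class v)).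
  - by rewrite scale1r.
  - exact: constant_classP.
  - exact: constant_classP.
  - by rewrite scale1r; exact: constant_classP.
have m0 : m (constant_class 0) = 0.
  by apply: (addrI (m (constant_class 0))); rewrite -mD !addr0.
pose z : 'M[HT]_n := \matrix_(i, j) constant_class (odot a b i j).
have mz : map_mx m z = mxalg_mul mul a b.
  apply/matrixP => i j; rewrite !mxE.
  rewrite (big_morph (fun t => m (constant_class t)) mD m0).
  by apply: eq_bigr => k _; apply: m_tens; exact: constant_classP.
rewrite -mz; apply: le_trans (m_cc n z) _.
have -> : haagerup_mxnorm z = hn (odot a b).
  apply: cvg_lim => //; apply: haagerup_norm_cvg => i j.
  rewrite (_ : (fun k => _) = (fun k =>
      norm1 hn (completion_repr (constant_class (odot a b i j)) k - odot a b i j))).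
    exact: converges_to_repr (constant_classP _).
  by apply/funext => k; rewrite 2!mxE.
rewrite -(rectnorm_square f_isometric) -[nA b](rectnorm_square f_isometric).
by apply: ge_inf; [exact: (haagerup_norm_lbound f_isometric)|exists n, a, b].
Qed.

Hypothesis matrix_algebras : matrix_banach_algebras mul nA.

(** Evaluated on a chosen representation; [mul_tensorE] gives independence of the choice. *)
Definition mul_tensor (t : T) : A := \sum_(xy <- sval (cid (tensorP t))) mul xy.1 xy.2.

Lemma opform_separates (a : A) : (forall z w, opform f a z w = 0) -> a = 0.
Proof.
move=> a0; apply/eqP; rewrite -normr_le0 -nA_norm.
have /(nA_leP f_isometric _ (lexx _)) : mxle (const_mx a : 'M[A]_1) (0 ^+ 2).
  move=> z w; rewrite !big_ord1 mxE a0 mulr0 expr0n mul0r addr0.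
  by rewrite sqr_ge0.
by [].
Qed.

(* Composing [mul] with vector functionals gives bilinear forms, so the
   functional [t] on bilinear forms determines the product. *)
Lemma mul_tensorE (s : seq (A * A)) :
  mul_tensor (\sum_(xy <- s) tens xy.1 xy.2) = \sum_(xy <- s) mul xy.1 xy.2.
Proof.
rewrite /mul_tensor; case: cid => s' /= ss'; apply/eqP; rewrite -subr_eq0; apply/eqP.
apply: opform_separates => z w; rewrite opformB.
pose B (x y : A) : R := opform f (mul x y) z w.
have Bl y : zmod_morphism (B ^~ y) by move=> a b; rewrite /B linearBl opformB.
have Br x : zmod_morphism (B x) by move=> a b; rewrite /B linearBr opformB.
have Bzl y : scalable_for *%R (B ^~ y) by move=> c a; rewrite /B linearZl_LR opformZ.
have Bzr x : scalable_for *%R (B x) by move=> c a; rewrite /B linearZr_LR opformZ.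
pose Bm := isBilinear.Build R A A R *%R *%R B Bl Br Bzl Bzr.
pose phi : bilinear_form A A := HB.pack B Bm.
have sumE (r : seq (A * A)) : opform f (\sum_(xy <- r) mul xy.1 xy.2) z w =
    val (\sum_(xy <- r) tens xy.1 xy.2) phi.
  rewrite val_tens_sum fct_sumE.
  by apply: (big_morph (fun a => opform f a z w)) => [a b|]; rewrite ?opformD ?opform0.
by rewrite !sumE -ss' subrr.
Qed.

Lemma mul_tensorD t u : mul_tensor (t + u) = mul_tensor t + mul_tensor u.
Proof.
have [s ->] := tensorP t; have [r ->] := tensorP u.
by rewrite -big_cat !mul_tensorE big_cat.
Qed.

Lemma mul_tensor_tens x y : mul_tensor (tens x y) = mul x y.
Proof.
have := mul_tensorE [:: (x, y)]; by rewrite !big_seq1.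
Qed.

Lemma mul_tensorZ c t : mul_tensor (c *: t) = c *: mul_tensor t.
Proof.
have [s ->] := tensorP t; rewrite scaler_sumr mul_tensorE scaler_sumr.
have := mul_tensorE [seq (c *: xy.1, xy.2) | xy <- s].
rewrite !big_map /= => h.
rewrite -(eq_bigr _ (fun xy _ => tensZl c xy.1 xy.2)) h.
by apply: eq_bigr => xy _; rewrite linearZl_LR.
Qed.

Lemma mul_tensor0 : mul_tensor 0 = 0.
Proof. by rewrite -(scale0r 0) mul_tensorZ scale0r. Qed.

Lemma mul_tensorB t u : mul_tensor (t - u) = mul_tensor t - mul_tensor u.
Proof. by rewrite -[- u]scaleN1r mul_tensorD mul_tensorZ scaleN1r. Qed.

(** Multiplication takes [odot x y] to the rectangular product [fmul x y]; both factors have squared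
    norm at most [r], so the product has squared norm at most [r * r]. *)
Lemma mxle_mul_tensor n (t : 'M[T]_n) r : hn t < r ->
  mxle (map_mx mul_tensor t) (r ^+ 2).
Proof.
move=> tr; have r0 : 0 < r := le_lt_trans (haagerup_norm_ge0 f_isometric t) tr.
have [p [x [y [tE xr yr]]]] := haagerup_le_of_lt f_isometric tr.
have := mxle_fmul f_isometric matrix_algebras (ltW r0) (ltW r0) xr yr.
rewrite -expr2; apply: eq_mxle => i j; rewrite mxE tE mxE.
rewrite (big_morph mul_tensor mul_tensorD mul_tensor0).
by apply: eq_bigr => k _; rewrite mul_tensor_tens.
Qed.

Lemma mul_tensor_le t : `|mul_tensor t| <= norm1 hn t.
Proof.
apply/ler_addgt0Pr => e e0.
have /mxle_mul_tensor : hn (const_mx t : 'M[T]_1) < norm1 hn t + e by rewrite ltrDl.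
have n0 : 0 <= norm1 hn t + e.
  by rewrite addr_ge0 ?(haagerup_norm1_ge0 f_isometric)// ltW.
move=> /(nA_leP f_isometric _ n0); rewrite -nA_norm; congr (_ <= _).
by congr (nA _); apply/matrixP => i j; rewrite !mxE.
Qed.

Lemma mul_tensor_cvg (u : nat -> T) : norm_cauchy hn u -> cvg (mul_tensor (u k) @[k --> \oo]).
Proof.
move=> uc; apply/cauchy_cvgP/cauchyP => e e0.
have [N uN] := uc e e0; exists (mul_tensor (u N)); exists N => // k /= Nk.
rewrite -ball_normE /= -mul_tensorB; apply: le_lt_trans (mul_tensor_le _) _.
exact: uN.
Qed.

Definition haagerup_mul (z : HT) : A := limn (fun k => mul_tensor (completion_repr z k)).

Lemma haagerup_mul_cvg (u : nat -> T) (z : HT) : converges_to u z ->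
  mul_tensor (u k) @[k --> \oo] --> haagerup_mul z.
Proof.
move=> uz; have h1 := mul_tensor_cvg (completion_repr_cauchy z).
have h2 : mul_tensor (completion_repr z k - u k) @[k --> \oo] --> (0 : A).
  apply/cvgr0Pnorm_le => e e0; have /cvgr0_norm_le/(_ e e0) := converges_to_repr uz.
  by apply: filterS => k; apply: le_trans; rewrite (le_trans (mul_tensor_le _))// ler_norm.
rewrite (_ : (fun k => _) = (fun k => mul_tensor (completion_repr z k) -
    mul_tensor (completion_repr z k - u k))); last first.
  by apply/funext => k /=; rewrite mul_tensorB opprB addrC subrK.
rewrite -[haagerup_mul z]subr0; exact: cvgB h1 h2.
Qed.

(** Needed because [completion_norm] is a [limn], which is meaningful only for convergent
    sequences. *)
Lemma completion_norm_cvg n (z : 'M[HT]_n) :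
  cvg (hn (\matrix_(i, j) completion_repr (z i j) k) @[k --> \oo]).
Proof.
apply/cauchy_cvgP/cauchyP => e e0.
have d0 : 0 < e / #|{: 'I_n * 'I_n}|.+1%:R by rewrite divr_gt0// ltr0n.
have [N NP] := choice (fun ij : 'I_n * 'I_n =>
  completion_repr_cauchy (z ij.1 ij.2) d0).
pose M := (\max_ij N ij)%N; pose r k := \matrix_(i, j) completion_repr (z i j) k.
exists (hn (r M)), M => // k /= Mk; rewrite -ball_normE /=.
apply: le_lt_trans (haagerup_norm_dist f_isometric _ _) _.
apply: (@le_lt_trans _ _ (\sum_(ij : 'I_n * 'I_n) e / #|{: 'I_n * 'I_n}|.+1%:R)).
  apply: ler_sum => ij _; rewrite !mxE; apply/ltW/NP; first exact: leq_bigmax.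
  exact: leq_trans (leq_bigmax ij) Mk.
rewrite sumr_const -[ltLHS]mulr_natl mulrCA gtr_pMr// ltr_pdivrMr ?ltr0n// mul1r.
by rewrite ltr_nat.
Qed.

Lemma haagerup_of_matrix_algebras : haagerup_multiplication_cc mul nA.
Proof.
exists haagerup_mul; split; first split.
- move=> c u v x y z ux vy uvz; have h := haagerup_mul_cvg uvz.
  apply: (cvg_unique _ h); first exact: norm_hausdorff.
  rewrite (_ : (fun k => _) =
      (fun k => c *: mul_tensor (u k) + mul_tensor (v k))); last first.
    by apply/funext => k /=; rewrite mul_tensorD mul_tensorZ.
  apply: cvgD (haagerup_mul_cvg vy); exact: cvgZl_tmp (haagerup_mul_cvg ux).
- move=> x y z xyz; have h := haagerup_mul_cvg xyz.
  apply: (cvg_unique _ h); first exact: norm_hausdorff.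
  rewrite mul_tensor_tens; exact: cvg_cst.
move=> n z; have zL := @completion_norm_cvg n z.
apply/ler_addgt0Pr => eps eps0.
have L0 : 0 <= haagerup_mxnorm z.
  by apply: limr_ge => //; near=> k; exact: (haagerup_norm_ge0 f_isometric).
have Le : 0 <= haagerup_mxnorm z + eps by rewrite addr_ge0// ltW.
apply/(nA_leP f_isometric _ Le).
apply: (mxle_approx f_isometric nA_norm) => e e0.
(* One index [k] must serve both purposes: the representatives have norm close to that of [z], and
   their products are entrywise close to the limit, as [mxle_approx] asks. *)
have n1 : \forall k \near \oo, hn (\matrix_(i, j) completion_repr (z i j) k) <
    haagerup_mxnorm z + eps.
  have := zL; move=> /cvgrPdist_lt/(_ eps eps0); apply: filterS => k.
  by rewrite ltr_norml => /andP[+ _]; rewrite -[lim _]/(haagerup_mxnorm z); lra.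
have n2 : \forall k \near \oo, forall ij : 'I_n * 'I_n,
    `|haagerup_mul (z ij.1 ij.2) - mul_tensor (completion_repr (z ij.1 ij.2) k)| <= e.
  apply: filter_forall => ij.
  by have /cvgrPdist_le/(_ e e0) := haagerup_mul_cvg (repr_converges_to (z ij.1 ij.2)).
have [k [k1 k2]] := filter_ex (filterI n1 n2).
exists (map_mx mul_tensor (\matrix_(i, j) completion_repr (z i j) k)).
  exact: mxle_mul_tensor.
by move=> i j; rewrite !mxE; exact: (k2 (i, j)).
Unshelve. all: by end_near.
Qed.

End HaagerupMultiplication.
Theorem theorem3p2 (R : realType) (A : completeNormedModType R)
    (nA : mxnorms R A) (mul : {bilinear A -> A -> A}) :
  real_operator_space nA ->
  banach_algebra mul ->
  approximately_unital mul ->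
  (haagerup_multiplication_cc mul nA <-> matrix_banach_algebras mul nA) /\
  (matrix_banach_algebras mul nA <-> real_operator_algebra mul nA).
Proof.
move=> [nA_norm [K [f [f_isometric _]]]] [mulA _] mul_unital; split; split.
- exact: matrix_algebras_of_haagerup f_isometric _.
- exact: haagerup_of_matrix_algebras f_isometric nA_norm _.
- by move=> mba; exact: (operator_algebra_of_matrix_algebras f_isometric nA_norm mulA mul_unital mba).
- exact: matrix_algebras_of_operator_algebra.
Qed.
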